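(* Let $k>1$ be a natural number, and for each $i\in[\ell]$ let $A_i(T,\mathbf{x},z)\in\mathbb{F}[T,\mathbf{x},z]$ and $\Phi_i(T,\mathbf{x})\in\mathbb{F}[T,\mathbf{x}]$, $\mathbf{x}=(x_1,\dots,x_n)$, satisfy: each $A_i$ is computable by a depth-$\Delta$ circuit of size $s$; each $A_i$ is $T$-regularized and monic in $z$; and $\Phi_i$ is a truncated, non-degenerate, approximate $z$-root of $A_i$ of order $k$. Let $\mathcal{S}$ be an $(n,\sigma,\mu,\rho)$-design, $g$ a $\sigma$-variate polynomial of degree $d$, and $\mathbf{w}$ a tuple of $\mu$ new variables. Let $C(T,\mathbf{x},y_1,\dots,y_\ell)$ be a circuit of depth $\Delta$ and size $s$ such that the polynomial $C'(T,\mathbf{x}):=C(T,\mathbf{x},\Phi_1,\dots,\Phi_\ell)$ is nonzero. If $C'(T,\mathbf{KI}_{g,\mathcal{S}}(\mathbf{w}))$ is identically zero, then $g$ can be computed by an algebraic circuit of depth $O(\Delta)$ and size $\mathrm{poly}(s,\deg(C'),k)\cdot(\rho\log k)^{\mathrm{poly}(d)}$.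
   Context: $\mathbb{F}$ is a field of characteristic zero; the $O(\cdot)$ and $\mathrm{poly}$ are absolute. Circuits: unbounded fan-in sum/product gates, size = edges, depth = longest path. A polynomial is monic in $z$ if its leading coefficient in $z$ is a nonzero constant; $A(T,\mathbf{x},z)$ is $T$-regularized if $A(0,\mathbf{x},z)\in\mathbb{F}[z]$. $\Phi$ is an approximate $z$-root of $A$ of order $k$ if $A(T,\mathbf{x},\Phi)\equiv0\bmod T^k$; truncated if $\deg_T\Phi<k$; non-degenerate if $(\partial_zA)(0,\mathbf{0},\Phi(0,\mathbf{0}))\ne0$. An $(n,\sigma,\mu,\rho)$-design is $S_1,\dots,S_n\subseteq[\mu]$ with $|S_i|=\sigma$, $|S_i\cap S_j|<\rho$ for $i\ne j$; $\mathbf{KI}_{g,\mathcal{S}}(\mathbf{w})=(g(\mathbf{w}_{S_1}),\dots,g(\mathbf{w}_{S_n}))$, and composition substitutes $x_i\mapsto g(\mathbf{w}_{S_i})$. *)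

(* Defs.v *)
From mathcomp Require Import all_boot all_order all_algebra.
From mathcomp.multinomials Require Import mpoly.

Set Implicit Arguments.
Unset Strict Implicit.
Unset Printing Implicit Defensive.

Import GRing.Theory.

Local Open Scope ring_scope.

(* Algebraic circuits are DAGs given by a topologically ordered sequence of
   gates: the naturals in [Add] and [Mul] are the positions of the children,
   with repetition allowed (parallel edges).  The output is the last gate. *)

Inductive gate (F : Type) (n : nat) : Type :=
| Const of F
| Var of 'I_n
| Add of seq nat
| Mul of seq nat.

Arguments Const {F n}.
Arguments Var {F n}.
Arguments Add {F n}.
Arguments Mul {F n}.

Section Circuit.

Variables (F : fieldType) (n : nat).

Definition children (g : gate F n) : seq nat :=
  match g with Const _ | Var _ => [::] | Add js | Mul js => js end.

Definition well_formed (gs : seq (gate F n)) : bool :=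
  (0 < size gs)%N &&
  all (fun i => all (fun j => j < i)%N (children (nth (Add [::]) gs i)))
      (iota 0 (size gs)).

Record circuit := Circuit {
  gates : seq (gate F n);
  gates_wf : well_formed gates
}.

(* The values of all gates in order, [f vs g] being the value of the gate [g]
   when [vs] lists the values of the gates before it. *)
Definition gate_scan (X : Type) (f : seq X -> gate F n -> X)
    (gs : seq (gate F n)) : seq X :=
  foldl (fun vs g => rcons vs (f vs g)) [::] gs.

Definition gate_poly (vs : seq {mpoly F[n]}) (g : gate F n) : {mpoly F[n]} :=
  match g with
  | Const c => c%:MP
  | Var i => 'X_i
  | Add js => \sum_(j <- js) vs`_j
  | Mul js => \prod_(j <- js) vs`_j
  end.

Definition circuit_poly (C : circuit) : {mpoly F[n]} :=
  last 0 (gate_scan gate_poly (gates C)).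

Definition gate_depth (ds : seq nat) (g : gate F n) : nat :=
  (\max_(j <- children g) (nth 0 ds j).+1)%N.

Definition circuit_depth (C : circuit) : nat :=
  (\max_(e <- gate_scan gate_depth (gates C)) e)%N.

Definition circuit_size (C : circuit) : nat :=
  (\sum_(g <- gates C) size (children g))%N.

Definition computable_by (p : {mpoly F[n]}) (Delta s : nat) : Prop :=
  exists C : circuit,
    [/\ circuit_poly C = p, (circuit_depth C <= Delta)%N
      & (circuit_size C <= s)%N].

End Circuit.

(* Total degree, with the convention that the zero polynomial has degree 0. *)
Definition mdegree (F : fieldType) (m : nat) (p : {mpoly F[m]}) : nat :=
  (msize p).-1.

(* Variable order: in F[T, x] = {mpoly F[n.+1]}, T is 'X_ord0 and x_i is
   'X_(lift ord0 i); F[T, x, z] = {mpoly F[n.+2]} has in addition z as its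
   last variable 'X_ord_max. *)

Section Roots.

Variables (F : fieldType) (n : nat).
Implicit Types (A : {mpoly F[n.+2]}) (Phi : {mpoly F[n.+1]}).

(* [muni A] is A as a polynomial in its last variable. *)
Definition monic_z A : Prop :=
  exists2 c : F, c != 0 & lead_coef (muni A) = c%:MP.

Definition subst_T0 A : {mpoly F[n.+2]} :=
  A \mPo [tuple (if i == ord0 then 0 else 'X_i) | i < n.+2].

Definition T_regularized A : Prop :=
  exists a : {poly F}, subst_T0 A = (map_poly (@mpolyC n.+2 F) a).['X_ord_max].

Definition subst_z A Phi : {mpoly F[n.+1]} :=
  A \mPo [tuple (if unlift ord_max i is Some j then 'X_j else Phi) | i < n.+2].

Definition approx_root (k : nat) A Phi : Prop :=
  exists Q : {mpoly F[n.+1]}, subst_z A Phi = Q * 'X_ord0 ^+ k.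

Definition truncated (k : nat) Phi : Prop :=
  forall m, m \in msupp Phi -> (m ord0 < k)%N.

Definition non_degenerate A Phi : Prop :=
  A^`M(ord_max).@[fun i => if i == ord_max then Phi.@[fun=> 0] else 0] != 0.

(* C(T, x, y_1, .., y_l) at y_i = Phi_i, where the first n.+1 variables of
   F[T, x, y] are those of F[T, x]. *)
Definition subst_y (l : nat) (C : {mpoly F[n.+1 + l]})
    (Phi : 'I_l -> {mpoly F[n.+1]}) : {mpoly F[n.+1]} :=
  C \mPo [tuple (match split i with inl j => 'X_j | inr j => Phi j end)
         | i < n.+1 + l].

End Roots.

Definition is_design (n sigma mu rho : nat) (S : 'I_n -> {set 'I_mu}) : Prop :=
  (forall i, #|S i| = sigma) /\
  (forall i j, i != j -> (#|S i :&: S j| < rho)%N).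

Section KI.

Variables (F : fieldType) (n sigma mu : nat).
Variables (g : {mpoly F[sigma]}) (S : 'I_n -> {set 'I_mu}).

(* The i-th coordinate g(w_{S_i}); [enum (S i)] lists S_i increasingly, and the
   default of nth is never reached when #|S i| = sigma. *)
Definition KI (i : 'I_n) : {mpoly F[mu]} :=
  g \mPo [tuple [seq 'X_v | v <- enum (S i)]`_j | j < sigma].

(* P(T, KI(w)) in F[T, w]: T stays the first variable, and w_v becomes
   'X_(lift ord0 v). *)
Definition subst_KI (P : {mpoly F[n.+1]}) : {mpoly F[mu.+1]} :=
  P \mPo [tuple (if unlift ord0 i is Some j
                 then KI j \mPo [tuple 'X_(lift ord0 v) | v < mu]
                 else 'X_ord0) | i < n.+1].

End KI.

(* Main.v *)
(** The dependence of C' on KI is removed one coordinate at a time: for some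
    i0, fixing T, the later coordinates and the variables outside S_(i0) leaves
    a nonzero polynomial R(w, z) with R(w, g(w)) = 0, in which every earlier
    coordinate g(w_(S_j)) depends on fewer than rho variables and is therefore a
    combination of rho^d products. After replacing R by a z-derivative, g is a
    simple root, and it is read off by Lagrange inversion on lines: if
    r(T, z) = alpha z - ... has the root c(T) modulo T^k, then, with
    G = z - r / alpha,
      [T^a] c = sum_(1 <= m <= 2k) 1/m [T^a z^(m-1)] G^m   for a < k,
    and the coefficients on the right are linear combinations of the values of
    G^m at points z = eta T, T = u. This closed form has constant depth. It is
    applied once to the truncated roots Phi_i of the A_i and once to g.

    The degrees of the A_i are not polynomially bounded in s, so the
    coefficients of T^j in A_i(T, x, phi + eta T) are not obtained by
    interpolating A_i as a whole: circuits are simulated gate by gate modulo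
    T^(3k), and only the truncated product at each multiplication gate is
    interpolated, which multiplies the depth by 5.

    When rho <= 1 the coordinates before i0 are constants, so g is a root of a
    nonzero univariate polynomial and hence constant. *)

Require Import Defs.
From Stdlib Require Import Classical_Prop.
From mathcomp Require Import all_boot all_order all_algebra.
From mathcomp.multinomials Require Import mpoly.
From mathcomp Require Import zify ring.

Set Implicit Arguments.
Unset Strict Implicit.
Unset Printing Implicit Defensive.

Import GRing.Theory.

Local Open Scope ring_scope.

(** * Lagrange inversion *)

Section Interpolation.

Variable F : fieldType.
Hypothesis F0 : [pchar F] =i pred0.

Lemma natr_inj_pchar0 : injective (fun m : nat => m%:R : F).
Proof.
move/pcharf0P: F0 => z.
have W a b : (a <= b)%N -> a%:R = b%:R :> F -> a = b.
  move=> leab E; apply/eqP; rewrite eqn_leq leab /= -subn_eq0 -z natrB //.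
  by rewrite E subrr.
by move=> a b E; case/orP: (leq_total a b) => /W; [apply | move=> /(_ (esym E))].
Qed.

(** The weights are the columns of the inverse Vandermonde matrix at 0, ..., E, nodes that are
    distinct in characteristic zero. For [j > E] zero weights serve, as no [i <= E] equals [j]. *)
Lemma interpolation_weights E : exists c : nat -> nat -> F,
  forall j i, (i <= E)%N -> \sum_(b < E.+1) c j b * b%:R ^+ i = (i == j)%:R.
Proof.
pose a := \row_(b < E.+1) (b%:R : F).
pose V := Vandermonde E.+1 a.
have uV : V \in unitmx.
  rewrite unitmxE det_Vandermonde unitfE; apply/prodf_neq0 => i _.
  apply/prodf_neq0 => b ltib; rewrite !mxE subr_eq0.
  apply/eqP => /natr_inj_pchar0; lia.
exists (fun j b => if (j <= E)%N then invmx V (inord b) (inord j) else 0) => j i leiE.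
have [lejE|ltEj] := leqP j E; last first.
  by rewrite big1 => [|b _]; rewrite ?mul0r // (_ : i == j = false) //; lia.
have := congr1 (fun M : 'M_E.+1 => M (inord i) (inord j)) (mulmxV uV).
rewrite !mxE -val_eqE /= !inordK // => <-; apply: eq_bigr => b _.
by rewrite !mxE inord_val inordK // mulrC.
Qed.

(** The scalars depend neither on [p] nor on [S], so the same weights act on polynomials over F and
    on polynomials with coefficients in [{mpoly F[n]}]. *)
Lemma coef_interpolation E : exists c : nat -> nat -> F,
  forall j (S : comNzRingType) (f : {rmorphism F -> S}) (p : {poly S}),
  (size p <= E.+1)%N -> p`_j = \sum_(b < E.+1) f (c j b) * p.[b%:R].
Proof.
have [c cP] := interpolation_weights E; exists c => j S f p sp.
have Ep b : p.[b%:R] = \sum_(i < E.+1) p`_i * b%:R ^+ i by rewrite (horner_coef_wide _ sp).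
transitivity (\sum_(i < E.+1) p`_i * f (\sum_(b < E.+1) c j b * b%:R ^+ i)).
  under eq_bigr => i _ do rewrite (cP j i (leq_ord i)) rmorph_nat mulr_natr mulrb.
  rewrite -big_mkcond /=.
  have [ltjE|leEj] := ltnP j E.+1; first by rewrite (big_pred1 (Ordinal ltjE)).
  rewrite nth_default ?(leq_trans sp) // big1 // => i /eqP ei.
  by have := ltn_ord i; rewrite ei ltnNge leEj.
under [RHS]eq_bigr => b _ do rewrite Ep mulr_sumr.
rewrite exchange_big; apply: eq_bigr => i _.
rewrite rmorph_sum mulr_sumr; apply: eq_bigr => b _.
by rewrite rmorphM rmorphXn rmorph_nat; ring.
Qed.

End Interpolation.

Section TruncatedEquality.

Variable R : comNzRingType.
Implicit Types x y : {poly R}.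

Definition eqT n x y : Prop := forall j, (j < n)%N -> x`_j = y`_j.

Lemma eqTM n x x' y y' : eqT n x x' -> eqT n y y' -> eqT n (x * y) (x' * y').
Proof.
move=> ex ey j ltj; rewrite !coefM; apply: eq_bigr => i _.
by rewrite ex ?ey //; have := ltn_ord i; lia.
Qed.

Lemma eqTX n x y m : eqT n x y -> eqT n (x ^+ m) (y ^+ m).
Proof. by move=> e; elim: m => // m IH; rewrite !exprS; apply: eqTM. Qed.

End TruncatedEquality.

(** * Lagrange inversion for z = G(T, z) through a telescoping residue sum *)

Section Lagrange.

Variables (F : fieldType) (k : nat).
Hypothesis F0 : [pchar F] =i pred0.
Implicit Types (P Q H W G : {poly {poly F}}) (x y c : {poly F}).

(* The weighted order for which T has weight 2 and z weight 1. *)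
Definition worder s P : Prop :=
  forall i j, (2 * j + i < s)%N -> P`_i`_j = 0.

Lemma worderM s t P Q : worder s P -> worder t Q -> worder (s + t) (P * Q).
Proof.
move=> oP oQ i j lt; rewrite coefM coef_sum big1 // => a _.
rewrite coefM big1 // => b _.
have := ltn_ord a; have := ltn_ord b => lb la.
have [l1|l1] := ltnP (2 * b + a) s; first by rewrite oP ?mul0r.
by rewrite oQ ?mulr0 //; lia.
Qed.

Lemma worder0 P : worder 0 P. Proof. by []. Qed.

Lemma worderX s P m : worder s P -> worder (s * m) (P ^+ m).
Proof.
move=> oP; elim: m => [|m IH]; first by rewrite muln0.
by rewrite exprS mulnS; apply: worderM.
Qed.

Variable G : {poly {poly F}}.
Hypothesis oG : worder 2 G.
(** From this cutoff on the tail vanishes modulo T^k: G^m has weighted order 2m, while z^m T^j with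
    j < k has weight 2j + m < 2m once m >= 2k. *)
Let M := (2 * k)%N.

(* The residue form of H(c), where c is the power series root of z = G(T, z):
   a truncation of sum_m [z^m] (1 - G') H G^m. *)
Definition residue_sum H : {poly F} :=
  \sum_(m < M.+1) ((1 - G^`()) * H * G ^+ m)`_m.

Lemma residue_sumD H H' : residue_sum (H + H') = residue_sum H + residue_sum H'.
Proof.
rewrite /residue_sum -big_split /=; apply: eq_bigr => m _.
by rewrite -coefD; congr (nth _ (polyseq _) _); ring.
Qed.

Lemma residue_sumZ c H : residue_sum (c%:P * H) = c * residue_sum H.
Proof.
rewrite /residue_sum mulr_sumr; apply: eq_bigr => m _.
by rewrite -coefCM; congr (nth _ (polyseq _) _); ring.
Qed.

Lemma residue_sum_small s H : (2 * M <= s)%N -> worder s H ->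
  eqT k (residue_sum H) 0.
Proof.
move=> les oH j ltj; rewrite coef0 coef_sum big1 // => m _.
have o : worder (s + 2 * m) (H * ((1 - G^`()) * G ^+ m)).
  rewrite -[(2 * m)%N]add0n; apply: worderM => //; apply: worderM (worder0 _) _.
  exact: worderX.
rewrite [(_ * H)]mulrC -mulrA o //.
by have := ltn_ord m; rewrite /M in les *; lia.
Qed.

(* The sum telescopes: (W z G^m)_m = (W G^m)_(m-1) for W = (1 - G') H. *)
Lemma residue_sum_ideal H : eqT k (residue_sum (('X - G) * H)) 0.
Proof.
pose f m := ((1 - G^`()) * H * G ^+ m.+1)`_m.
have -> : residue_sum (('X - G) * H) = - f M.
  rewrite /residue_sum; elim: M => [|n IH].
    rewrite big_ord_recl big_ord0 addr0 expr0 mulr1 /f expr1.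
    rewrite (_ : _ * _ = (1 - G^`()) * H * 'X - (1 - G^`()) * H * G); last by ring.
    by rewrite coefB coefMX sub0r.
  rewrite big_ord_recr /= IH /f.
  rewrite (_ : (1 - _) * (_ * H) * _ =
     (1 - G^`()) * H * G ^+ n.+1 * 'X - (1 - G^`()) * H * G ^+ n.+2); last first.
    by rewrite (exprS G n.+1); ring.
  by rewrite coefB coefMX /= addKr.
move=> j ltj; rewrite coef0 coefN.
have o : worder (0 + 2 * M.+1) ((1 - G^`()) * H * G ^+ M.+1).
  by apply: worderM (worder0 _) _; apply: worderX.
by rewrite o ?oppr0 // /M; lia.
Qed.

Lemma mulrn_inj_char0 m x y : x *+ m.+1 = y *+ m.+1 -> x = y.
Proof.
move=> /eqP; rewrite -subr_eq0 -mulrnBl -mulr_natr mulf_eq0 subr_eq0.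
case/orP => [/eqP //|]; move/pcharf0P: F0 => z.
by rewrite -(rmorph_nat (@polyC F)) polyC_eq0 z.
Qed.

Lemma coef_deriv_mulX m i :
  (G^`() * G ^+ m)`_i *+ m.+1 = (G ^+ m.+1)`_i.+1 *+ i.+1.
Proof.
by rewrite -coef_deriv deriv_exp -coefMn.
Qed.

Lemma coef_small m j : (m >= M)%N -> (j < k)%N -> ((G ^+ m.+1)`_m)`_j = 0.
Proof. by move=> le lt; apply: (worderX (m := m.+1) oG); rewrite /M in le *; lia. Qed.

(** By [coef_deriv_mulX], [z^m] G' G^m = [z^(m+1)] G^(m+1), so the sum telescopes from [z^0] G^0 =
    1; the weighted order kills the boundary term modulo T^k. *)
Lemma residue_sum1 : eqT k (residue_sum 1) 1.
Proof.
have -> : residue_sum 1 = 1 - (G ^+ M.+1)`_M.+1.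
  rewrite /residue_sum; elim: M => [|n IH].
    rewrite big_ord_recl big_ord0 addr0 expr0 !mulr1 expr1 coefB.
    by rewrite coef1 coef_deriv.
  rewrite big_ord_recr /= IH mulr1 mulrBl mul1r coefB.
  rewrite (mulrn_inj_char0 (coef_deriv_mulX n.+1 n.+1)); ring.
move=> j ltj; rewrite coefB (_ : ((G ^+ M.+1)`_M.+1)`_j = 0) ?subr0 //.
by apply: (worderX (m := M.+1) oG); rewrite /M; lia.
Qed.

(** In terms of [g], the summand of index m + 1 is (m + 1) g(m) - (m + 1) g(m + 1). Abel summation
    leaves the Lagrange terms g(m) and a boundary term that [coef_small] removes. *)
Lemma residue_sumX : eqT k (residue_sum 'X)
  (\sum_(m < M) (m.+1%:R^-1)%:P * (G ^+ m.+1)`_m).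
Proof.
pose g m := (m.+1%:R^-1)%:P * (G ^+ m.+1)`_m.
have gE m : (G ^+ m.+1)`_m = g m *+ m.+1.
  rewrite -mulr_natl mulrA -(rmorph_nat (@polyC F)) -polyCM divff ?mul1r //.
  by move/pcharf0P: F0 => ->.
have -> : residue_sum 'X = \sum_(m < M) g m - g M *+ M.
  rewrite /residue_sum; elim: M => [|n IH].
    rewrite big_ord_recl !big_ord0 expr0 !mulr1 addr0 subr0.
    by rewrite coefMX.
  rewrite big_ord_recr /= IH [\sum_(m < n.+1) _]big_ord_recr /=.
  rewrite (_ : _ * 'X * _ = (G ^+ n.+1 - G^`() * G ^+ n.+1) * 'X); last by ring.
  rewrite coefMX /= coefB gE.
  have -> : (G^`() * G ^+ n.+1)`_n = g n.+1 *+ n.+1.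
    apply: (@mulrn_inj_char0 n.+1); rewrite coef_deriv_mulX gE.
    by rewrite -!mulrnA mulnC.
  by rewrite mulrS; ring.
move=> j ltj; rewrite coefB coefMn /g coefCM coef_small //.
by rewrite mulr0 mul0rn subr0.
Qed.

(* U is invertible for the weighted order, so that z - c lies in the ideal
   (z - G) up to high order: replacing H by (1 - U) H does not change the value
   of residue_sum on (z - c) H, and raises the order of H. *)
Lemma lagrange_inversion c e U :
  c`_0 = 0 -> eqT k e 0 -> 'X - G = ('X - c%:P) * U + e%:P ->
  forall a, (a < k)%N ->
  c`_a = \sum_(m < M) m.+1%:R^-1 * ((G ^+ m.+1)`_m)`_a.
Proof.
move=> c0 e0 defG.
have [->//|k_gt0] := posnP k.
(* Comparison of the coefficients of z T^0 in [defG]: G has none, since it has weighted order 2, and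
   c has no constant term. *)
have U1 : U`_0`_0 = 1.
  have := congr1 (fun P => P`_1`_0) defG.
  rewrite mulrBl !(coefB, coefD, coefC, coefX, coefXM, coefCM) /=.
  by rewrite addr0 oG // coefM big_ord_recl big_ord0 c0 mul0r !addr0 !subr0 => <-.
have oN : worder 1 (1 - U).
  by case=> [|i] [|j] //= _; rewrite coefB coef1 coefB U1 coef1 subrr.
have eqN i : eqT k (residue_sum (('X - c%:P) * (1 - U) ^+ i)) 0.
  have eqS n : eqT k (residue_sum (('X - c%:P) * (1 - U) ^+ n))
                     (residue_sum (('X - c%:P) * (1 - U) ^+ n.+1)).
    rewrite (_ : ('X - c%:P) * (1 - U) ^+ n = ('X - c%:P) * (1 - U) ^+ n.+1 +
       (('X - G) * (1 - U) ^+ n + (- e)%:P * (1 - U) ^+ n)); last first.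
      by rewrite exprS defG rmorphN /=; ring.
    rewrite residue_sumD [residue_sum (_ * _ + _)]residue_sumD residue_sumZ => j ltj.
    rewrite coefD coefD residue_sum_ideal // coef0 add0r.
    have e1 : eqT k (- e) 0 by move=> b ltb; rewrite coefN e0 // !coef0 oppr0.
    by rewrite (eqTM e1 (fun b _ => erefl (residue_sum ((1 - U) ^+ n))`_b) ltj) mul0r coef0 addr0.
  have eqA n : eqT k (residue_sum (('X - c%:P) * (1 - U) ^+ i))
                     (residue_sum (('X - c%:P) * (1 - U) ^+ (i + n))).
    elim: n => [|n IH] j ltj; first by rewrite addn0.
    by rewrite IH // eqS // addnS.
  (* Each factor 1 - U adds one to the weighted order, so 2M further factors suffice for
     [residue_sum_small]. *)
  move=> j ltj; rewrite (eqA (2 * M)%N) //.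
  apply: (@residue_sum_small (0 + 1 * (i + 2 * M))) => //; first by lia.
  by apply: worderM (worder0 _) _; apply: worderX.
move=> a lta; have := residue_sumX lta.
(* From z = (z - c) + c * 1, [residue_sum 'X] agrees modulo T^k with c times [residue_sum 1], hence
   with c. *)
rewrite (_ : 'X = ('X - c%:P) * (1 - U) ^+ 0 + c%:P * 1); last by rewrite expr0 !mulr1; ring.
rewrite residue_sumD residue_sumZ coefD eqN // coef0 add0r.
have -> : (c * residue_sum 1)`_a = (c * 1)`_a.
  exact: (eqTM (fun b _ => erefl c`_b) residue_sum1 lta).
rewrite mulr1 => ->; rewrite coef_sum; apply: eq_bigr => m _.
by rewrite coefCM.
Qed.

End Lagrange.

(** * A closed formula for the value of an approximate root *)

Section RootFormula.

Variable F : fieldType.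
Hypothesis F0 : [pchar F] =i pred0.

Lemma coef_horner_scaleT (P : {poly {poly F}}) (eta : F) n :
  (P.[eta%:P * 'X])`_n = \sum_(i < n.+1) P`_i`_(n - i) * eta ^+ i.
Proof.
rewrite (horner_coef_wide _ (leq_maxl (size P) n.+1)) coef_sum.
rewrite [RHS](big_ord_widen _ (fun i => P`_i`_(n - i) * eta ^+ i) (leq_maxr (size P) n.+1)).
rewrite [RHS]big_mkcond; apply: eq_bigr => i _.
rewrite exprMn -rmorphXn /= mulrCA coefCM coefMXn ltnS.
by case: leqP; rewrite ?mulr0 // mulrC.
Qed.

(** On the line z = eta T, the coefficient of T^(i + j) is a polynomial in eta whose coefficient of
    eta^i is the one sought, so interpolation in eta isolates it. *)
Lemma coef_coef_interpolation N : exists c : nat -> nat -> F,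
  forall i j (P : {poly {poly F}}), (i + j <= N)%N ->
  P`_i`_j = \sum_(eta < N.+1) c i eta * (P.[eta%:R%:P * 'X])`_(i + j).
Proof.
have [c cP] := interpolation_weights F0 N; exists c => i j P le.
under eq_bigr => eta _ do rewrite coef_horner_scaleT mulr_sumr.
rewrite exchange_big /=.
transitivity (\sum_(b < (i + j).+1) P`_b`_(i + j - b) * (b == i :> nat)%:R); last first.
  apply: eq_bigr => b _; rewrite -(cP i); last by have := ltn_ord b; lia.
  by rewrite mulr_sumr; apply: eq_bigr => eta _; ring.
under eq_bigr => b _ do rewrite mulr_natr mulrb.
rewrite -big_mkcond /= (big_pred1 (inord i)) => [|b]; last first.
  by rewrite -[RHS]/(val b == val (inord i)) /= inordK //; lia.
by rewrite inordK ?addKn //; lia.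
Qed.

(** Lagrange inversion combined with two interpolations, in the slope eta and in T. The weights are
    chosen before [r], [c] and [rho]; hence one formula serves all evaluation points at once and
    becomes a polynomial identity. The truncations [rho] allow [r] to have unbounded degree in T. *)
Lemma approximate_root_value k E (alpha t : F) : exists w : nat -> nat -> nat -> F,
  forall (r : {poly {poly F}}) (c : {poly F}) (rho : nat -> {poly F}),
  alpha != 0 -> r`_0`_0 = 0 -> r`_1`_0 = alpha -> c`_0 = 0 ->
  eqT k r.[c] 0 -> (size c <= k)%N ->
  (forall eta, (size (rho eta) <= E.+1)%N) ->
  (forall eta, eqT (3 * k) (rho eta) r.[eta%:R%:P * 'X]) ->
  c.[t] = \sum_(m < 2 * k) \sum_(u < (E.+1 * (2 * k)).+1) \sum_(eta < (3 * k).+1)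
     w m u eta * (eta%:R * u%:R - alpha^-1 * (rho eta).[u%:R]) ^+ m.+1.
Proof.
(* The coefficients read are those of z^m T^a with m < 2k and a < k, of total degree below 3k. In
   the second interpolation, E + 1 bounds the degree both of [rho eta] and, even for E = 0, of the
   linear term eta T. *)
have [c1 c1P] := coef_coef_interpolation (3 * k).
have [c2 c2P] := coef_interpolation F0 (E.+1 * (2 * k)).
exists (fun m u eta => \sum_(a < k)
  t ^+ a * m.+1%:R^-1 * c1 m eta * c2 (m + a)%N u).
move=> r c rho alpha0 r00 r10 c0 rc sc srho rhoE.
(* Dividing by the slope cancels the term z; together with [r00] this removes both monomials of
   weight below 2. *)
pose G := 'X - (alpha^-1)%:P%:P * r.
have oG : worder 2 G.
  case=> [|[|i]] [|j] lt; try lia; rewrite /G coefB coefX coefCM coefB coefCM.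
  - by rewrite r00 mulr0 coef0 subr0.
  - by rewrite r10 mulVf // coef1 subrr.
pose e := (alpha^-1)%:P * r.[c].
(* z - c divides r - r(c); the error [e] is r(c) / alpha, which vanishes modulo T^k. *)
have [U defU] : exists U, 'X - G = ('X - c%:P) * U + e%:P.
  have /factor_theorem[q qE] : root (r - r.[c]%:P) c.
    by rewrite /root !hornerE subrr.
  exists ((alpha^-1)%:P%:P * q); rewrite /G /e rmorphM /=.
  by rewrite -[in LHS](subrK (r.[c]%:P) r) qE; ring.
have e0 : eqT k e 0 by move=> j lt; rewrite coefCM rc // !coef0 mulr0.
have lag := lagrange_inversion F0 oG c0 e0 defU.
rewrite (horner_coef_wide _ sc).
transitivity (\sum_(a < k) \sum_(m < 2 * k) \sum_(eta < (3 * k).+1)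
   \sum_(u < (E.+1 * (2 * k)).+1) t ^+ a * m.+1%:R^-1 * c1 m eta * c2 (m + a)%N u *
   (eta%:R * u%:R - alpha^-1 * (rho eta).[u%:R]) ^+ m.+1).
  apply: eq_bigr => a _; rewrite lag // mulr_suml; apply: eq_bigr => m _.
  have lta := ltn_ord a; have ltm := ltn_ord m.
  rewrite c1P; last by lia.
  rewrite mulr_sumr mulr_suml; apply: eq_bigr => eta _.
  pose q := (eta%:R%:P * 'X - (alpha^-1)%:P * rho eta) ^+ m.+1.
  have sq : (size q <= (E.+1 * (2 * k)).+1)%N.
    apply: (leq_trans (size_poly_exp_leq _ _)); rewrite ltnS leq_mul //.
    rewrite -subn1 leq_subLR add1n (leq_trans (size_polyD _ _)) // geq_max size_polyN.
    rewrite !mul_polyC !(leq_trans (size_scale_leq _ _)) ?size_polyX //.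
    exact: leq_trans (srho eta) _.
  have -> : (G ^+ m.+1).[eta%:R%:P * 'X]`_(m + a) = q`_(m + a).
    rewrite horner_exp; apply: (eqTX (n := 3 * k)); last by lia.
    move=> j ltj; rewrite /G !hornerE !coefB; congr (_ - _).
    by rewrite !coefCM rhoE.
  rewrite (c2P _ _ idfun _ sq) mulr_sumr mulr_sumr mulr_suml; apply: eq_bigr => u _.
  rewrite /q horner_exp hornerD hornerN !hornerCM hornerX /=; ring.
rewrite exchange_big; apply: eq_bigr => m _ /=.
under [RHS]eq_bigr => u _ do under eq_bigr => eta _ do rewrite mulr_suml.
under [RHS]eq_bigr => u _ do rewrite exchange_big.
rewrite [RHS]exchange_big; apply: eq_bigr => a _ /=.
by rewrite exchange_big.
Qed.

End RootFormula.

(** * Circuits *)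

Section GateLists.

Variables (F : fieldType) (n : nat).
Implicit Types (gs : seq (gate F n)) (g : gate F n) (p : {mpoly F[n]}).

Definition topological gs : bool :=
  all (fun i => all (fun j => j < i)%N (children (nth (Add [::]) gs i)))
      (iota 0 (size gs)).

Lemma gate_scan_rcons X (f : seq X -> gate F n -> X) gs g :
  gate_scan f (rcons gs g) = rcons (gate_scan f gs) (f (gate_scan f gs) g).
Proof. by rewrite /gate_scan -cats1 foldl_cat. Qed.

Lemma size_gate_scan X (f : seq X -> gate F n -> X) gs :
  size (gate_scan f gs) = size gs.
Proof.
by elim/last_ind: gs => // gs g IH; rewrite gate_scan_rcons !size_rcons IH.
Qed.

Lemma gate_scan_cat X (f : seq X -> gate F n -> X) gs gs' :
  exists xs, gate_scan f (gs ++ gs') = gate_scan f gs ++ xs.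
Proof.
elim/last_ind: gs' => [|gs' g [xs IH]]; first by exists [::]; rewrite !cats0.
by exists (rcons xs (f (gate_scan f (gs ++ gs')) g)); rewrite -rcons_cat gate_scan_rcons IH rcons_cat.
Qed.

Lemma nth_gate_scan_cat X (x0 : X) (f : seq X -> gate F n -> X) gs gs' j :
  (j < size gs)%N -> nth x0 (gate_scan f (gs ++ gs')) j = nth x0 (gate_scan f gs) j.
Proof.
by move=> lt; have [xs ->] := gate_scan_cat f gs gs'; rewrite nth_cat size_gate_scan lt.
Qed.

Lemma topological_rcons gs g :
  topological (rcons gs g) = topological gs && all (fun j => j < size gs)%N (children g).
Proof.
rewrite /topological size_rcons -[(size gs).+1]addn1 iotaD all_cat /= add0n andbT.
rewrite nth_rcons ltnn eqxx; congr (_ && _).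
by apply: eq_in_all => i; rewrite mem_iota => /= lt; rewrite nth_rcons lt.
Qed.

Lemma topological_catl gs gs' : topological (gs ++ gs') -> topological gs.
Proof.
elim/last_ind: gs' => [|gs' g IH]; first by rewrite cats0.
by rewrite -rcons_cat topological_rcons => /andP[/IH].
Qed.

Definition edges gs : nat := (\sum_(g <- gs) size (children g))%N.

Definition depth_of gs j : nat := nth 0%N (gate_scan (@gate_depth F n) gs) j.

Definition value_of gs j : {mpoly F[n]} := (gate_scan (@gate_poly F n) gs)`_j.

Definition has_at gs D p : Prop :=
  exists j, [/\ (j < size gs)%N, value_of gs j = p & (depth_of gs j <= D)%N].

Lemma has_at_cat gs gs' D p : has_at gs D p -> has_at (gs ++ gs') D p.
Proof.
case=> j [lt v d]; exists j; split.
- by rewrite size_cat ltn_addr.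
- by rewrite /value_of nth_gate_scan_cat.
- by rewrite /depth_of nth_gate_scan_cat.
Qed.

Definition avail := nat -> {mpoly F[n]} -> Prop.
Implicit Types (Q R : avail).

(** Upward closed in the depth, so that a shallow gate can be used wherever a larger depth bound is
    expected. *)
Definition only D p : avail := fun D' p' => (D <= D')%N /\ p' = p.

Definition availU Q R : avail := fun D p => Q D p \/ R D p.

(* From any circuit in which the pairs (depth bound, polynomial) of [Q] are
   available, those of [R] become available at the cost of [c] new edges. *)
Definition step Q c R : Prop :=
  forall gs, topological gs -> (forall D p, Q D p -> has_at gs D p) ->
  exists gs', [/\ topological (gs ++ gs'), (edges gs' <= c)%N
                & forall D p, R D p -> has_at (gs ++ gs') D p].

Lemma stepW Q Q' c c' R R' : step Q c R ->
  (forall D p, Q D p -> Q' D p) -> (c <= c')%N -> (forall D p, R' D p -> R D p) ->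
  step Q' c' R'.
Proof.
move=> st QQ' cc' RR' gs tgs hQ; have [|gs' [t e h]] := st gs tgs.
  by move=> D p /QQ'/hQ.
exists gs'; split=> //; first exact: leq_trans cc'.
by move=> D p /RR'/h.
Qed.

(** Appending gates changes neither the values nor the depths of the earlier ones, so the second
    step may read what the first one read and produced. *)
Lemma step_trans Q c R c' R' : step Q c R -> step (availU Q R) c' R' ->
  step Q (c + c') (availU R R').
Proof.
move=> st st' gs tgs hQ; have [gs1 [t1 e1 h1]] := st gs tgs hQ.
have [|gs2 [t2 e2 h2]] := st' (gs ++ gs1) t1.
  by move=> D p [/hQ /has_at_cat|/h1].
exists (gs1 ++ gs2); rewrite catA; split=> //.
  by rewrite /edges big_cat leq_add.
by move=> D p [/h1 /has_at_cat|/h2].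
Qed.

Lemma step0 Q R : (forall D p, R D p -> Q D p) -> step Q 0 R.
Proof.
move=> RQ gs tgs hQ; exists [::]; rewrite cats0; split=> //.
  by rewrite /edges big_nil.
by move=> D p /RQ/hQ.
Qed.

Lemma step_seq (I : eqType) (r : seq I) Q (c : I -> nat) (R : I -> avail) :
  (forall i, i \in r -> step Q (c i) (R i)) ->
  step Q (\sum_(i <- r) c i) (fun D p => exists2 i, i \in r & R i D p).
Proof.
elim: r => [|i r IH] st.
  by rewrite big_nil; apply: step0 => D p [].
have st2 : step (availU Q (R i)) (\sum_(j <- r) c j) (fun D p => exists2 j, j \in r & R j D p).
  apply: (stepW (IH _)) => //; last by move=> D p; left.
  by move=> x xr; apply: st; rewrite inE xr orbT.
rewrite big_cons; apply: (stepW (step_trans (st i (mem_head _ _)) st2)) => // D p [x].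
by rewrite inE => /predU1P[-> ?|xr ?]; [left|right; exists x].
Qed.

Lemma step_seq_const (I : eqType) (r : seq I) Q c (R : I -> avail) :
  (forall i, i \in r -> step Q c (R i)) ->
  step Q (size r * c) (fun D p => exists2 i, i \in r & R i D p).
Proof.
move=> st; apply: (stepW (step_seq st)) => //.
by rewrite big_const_seq count_predT iter_addn_0 mulnC.
Qed.

(** The gate is chosen after [gs], because the positions of its children depend on the list; [js]
    fixes the number of new edges. *)
Lemma step_gate Q D p (js : seq nat) :
  (forall gs, topological gs -> (forall D p, Q D p -> has_at gs D p) ->
   exists g, [/\ size (children g) = size js,
     all (fun j => j < size gs)%N (children g),
     gate_poly (gate_scan (@gate_poly F n) gs) g = p &
     (gate_depth (gate_scan (@gate_depth F n) gs) g <= D)%N]) ->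
  step Q (size js) (only D p).
Proof.
move=> H gs tgs hQ; have [g [sg lg vg dg]] := H gs tgs hQ.
exists [:: g]; rewrite cats1 topological_rcons tgs lg; split=> //.
  by rewrite /edges big_seq1 sg.
move=> D' p' [leD ->]; exists (size gs); rewrite size_rcons ltnSn; split=> //.
  by rewrite /value_of gate_scan_rcons nth_rcons size_gate_scan ltnn eqxx.
by rewrite /depth_of gate_scan_rcons nth_rcons size_gate_scan ltnn eqxx (leq_trans dg).
Qed.

Lemma step_const Q D a : step Q 0 (only D a%:MP).
Proof.
apply: (@step_gate _ _ _ [::]) => gs _ _; exists (Const a); split=> //.
by rewrite /gate_depth big_nil.
Qed.

Lemma step_var Q D i : step Q 0 (only D 'X_i).
Proof.
apply: (@step_gate _ _ _ [::]) => gs _ _; exists (Var i); split=> //.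
by rewrite /gate_depth big_nil.
Qed.

Lemma has_at_indices gs D (I : eqType) (r : seq I) (x : I -> {mpoly F[n]}) :
  (forall i, i \in r -> has_at gs D (x i)) ->
  exists js, [/\ all (fun j => j < size gs)%N js, map (value_of gs) js = map x r
               & all (fun j => depth_of gs j <= D)%N js].
Proof.
elim: r => [|i r IH] h; first by exists [::].
have [|js [h1 h2 h3]] := IH; first by move=> y yr; apply: h; rewrite inE yr orbT.
have [j [l v d]] := h i (mem_head _ _).
by exists (j :: js); rewrite /= l h1 v h2 d h3.
Qed.

Lemma gate_depth_le gs D js :
  all (fun j => depth_of gs j <= D)%N js ->
  (\max_(j <- js) (depth_of gs j).+1 <= D.+1)%N.
Proof. by move=> /allP h; apply/bigmax_leqP_seq => j jr _; rewrite ltnS h. Qed.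

Lemma step_sum (I : eqType) (r : seq I) Q D (x : I -> {mpoly F[n]}) :
  (forall i, i \in r -> Q D (x i)) ->
  step Q (size r) (only D.+1 (\sum_(i <- r) x i)).
Proof.
move=> Qx; rewrite -(size_map (fun=> 0%N)).
apply: (@step_gate _ _ _ _) => gs _ hQ.
have [|js [h1 h2 h3]] := @has_at_indices gs D _ r x; first by move=> i /Qx/hQ.
exists (Add js); split=> //=.
- by rewrite size_map -(size_map (value_of gs)) h2 size_map.
- by rewrite -(big_map (value_of gs) xpredT id) h2 big_map.
- exact: gate_depth_le.
Qed.

Lemma step_prod (I : eqType) (r : seq I) Q D (x : I -> {mpoly F[n]}) :
  (forall i, i \in r -> Q D (x i)) ->
  step Q (size r) (only D.+1 (\prod_(i <- r) x i)).
Proof.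
move=> Qx; rewrite -(size_map (fun=> 0%N)).
apply: (@step_gate _ _ _ _) => gs _ hQ.
have [|js [h1 h2 h3]] := @has_at_indices gs D _ r x; first by move=> i /Qx/hQ.
exists (Mul js); split=> //=.
- by rewrite size_map -(size_map (value_of gs)) h2 size_map.
- by rewrite -(big_map (value_of gs) xpredT id) h2 big_map.
- exact: gate_depth_le.
Qed.

(** Each summand takes two edges for scaling and one edge into the sum gate. *)
Lemma step_lin (I : eqType) (r : seq I) Q D (a : I -> F) (x : I -> {mpoly F[n]}) :
  (forall i, i \in r -> Q D (x i)) ->
  step Q (3 * size r) (only D.+2 (\sum_(i <- r) (a i)%:MP * x i)).
Proof.
move=> Qx.
have s1 : step Q (size r * 2) (fun D' p => exists2 i, i \in r & only D.+1 ((a i)%:MP * x i) D' p).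
  apply: step_seq_const => i ir.
  have st : step (availU Q (only D (a i)%:MP)) 2 (only D.+1 ((a i)%:MP * x i)).
    have -> : (a i)%:MP * x i = \prod_(p <- [:: (a i)%:MP; x i]) id p.
      by rewrite !big_cons big_nil mulr1.
    apply: (@step_prod _ [:: (a i)%:MP; x i] _ D id) => p.
    rewrite !inE => /orP[]/eqP->; last by left; apply: Qx.
    by right.
  by apply: (stepW (step_trans (@step_const Q D (a i)) st)) => // D' p; right.
have s2 := @step_sum I r
  (availU Q (fun D' p => exists2 i, i \in r & only D.+1 ((a i)%:MP * x i) D' p))
  D.+1 (fun i => (a i)%:MP * x i).
apply: (stepW (step_trans s1 (s2 _))) => //; [|lia|by move=> D' p; right].
by move=> i ir; right; exists i.
Qed.

Lemma value_of_rcons gs g j : value_of (rcons gs g) j =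
  if (j == size gs)%N then gate_poly (gate_scan (@gate_poly F n) gs) g else value_of gs j.
Proof.
rewrite /value_of gate_scan_rcons nth_rcons size_gate_scan.
by case: ltngtP => // lt; rewrite nth_default // size_gate_scan ltnW.
Qed.

Lemma depth_of_rcons gs g j : depth_of (rcons gs g) j =
  if (j == size gs)%N then gate_depth (gate_scan (@gate_depth F n) gs) g else depth_of gs j.
Proof.
rewrite /depth_of gate_scan_rcons nth_rcons size_gate_scan.
by case: ltngtP => // lt; rewrite nth_default // size_gate_scan ltnW.
Qed.

Lemma eq_gate_poly gs gs' g :
  (forall j, j \in children g -> value_of gs j = value_of gs' j) ->
  gate_poly (gate_scan (@gate_poly F n) gs) g = gate_poly (gate_scan (@gate_poly F n) gs') g.
Proof. by case: g => //= js e; apply: eq_big_seq => j /e. Qed.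

Lemma eq_gate_depth gs gs' g :
  (forall j, j \in children g -> depth_of gs j = depth_of gs' j) ->
  gate_depth (gate_scan (@gate_depth F n) gs) g =
  gate_depth (gate_scan (@gate_depth F n) gs') g.
Proof. by move=> e; apply: eq_big_seq => j /e; rewrite /depth_of => ->. Qed.

Lemma child_depth gs g j : j \in children g ->
  (depth_of gs j < gate_depth (gate_scan (@gate_depth F n) gs) g)%N.
Proof.
move=> jg; rewrite /gate_depth (big_rem j) //=; exact: leq_maxl.
Qed.

(* Gates of depth at most D never read deeper ones, so the latter can be
   overwritten by constants. *)
Lemma prune_depth gs D : topological gs -> exists gs',
  [/\ size gs' = size gs, topological gs', (edges gs' <= edges gs)%N,
      forall j, (depth_of gs' j <= D)%N &
      forall j, (j < size gs)%N -> (depth_of gs j <= D)%N ->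
        value_of gs' j = value_of gs j /\ depth_of gs' j = depth_of gs j].
Proof.
elim/last_ind: gs => [_|gs g IH].
  by exists [::]; split=> // j; rewrite /depth_of nth_nil.
rewrite topological_rcons => /andP[/IH[gs' [s1 t1 e1 d1 v1]] lg].
have [leD|ltD] := leqP (gate_depth (gate_scan (@gate_depth F n) gs) g) D; last first.
  exists (rcons gs' (Const 0)); rewrite !size_rcons s1 topological_rcons t1; split=> //.
  - by rewrite /edges -!cats1 !big_cat leq_add // big_seq1.
  - by move=> j; rewrite depth_of_rcons; case: ifP => // _; rewrite /gate_depth big_nil.
  move=> j; rewrite ltnS depth_of_rcons !value_of_rcons depth_of_rcons s1.
  case: eqP => [_ _|/eqP ne le]; first by rewrite leqNgt ltD.
  by apply: v1; rewrite ltn_neqAle ne.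
have cd j : j \in children g -> value_of gs' j = value_of gs j /\ depth_of gs' j = depth_of gs j.
  move=> jg; apply: v1; first exact: (allP lg).
  exact: leq_trans (ltnW (child_depth gs jg)) leD.
have ev := eq_gate_poly (fun j jg => (cd j jg).1).
have ed := eq_gate_depth (fun j jg => (cd j jg).2).
exists (rcons gs' g); rewrite !size_rcons s1 topological_rcons t1 s1 lg; split=> //.
- by rewrite /edges -!cats1 !big_cat leq_add.
- by move=> j; rewrite depth_of_rcons; case: ifP => // _; rewrite ed.
move=> j; rewrite ltnS !depth_of_rcons !value_of_rcons s1 ev ed.
by case: eqP => // /eqP ne le; apply: v1; rewrite ltn_neqAle ne.
Qed.

(** The depth of a circuit is a maximum over all its gates and its output is the last gate. So the
    deep gates are pruned first, and the list is then cut after the gate that holds [p]. *)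
Lemma step_computable s D p : step (fun _ _ => False) s (only D p) -> computable_by p D s.
Proof.
move=> /(_ [::] isT)[//|gs [t e /(_ D p (conj (leqnn D) erefl)) [j [lt v d]]]].
rewrite cat0s in t lt v d.
have [gs' [s1 t1 e1 d1 v1]] := prune_depth D t.
have [v2 d2] := v1 j lt d; rewrite {}v in v2.
pose gs2 := take j.+1 gs'.
have sgs2 : size gs2 = j.+1 by rewrite size_takel // s1.
have e2 : gs2 ++ drop j.+1 gs' = gs' by rewrite cat_take_drop.
have wf : well_formed gs2.
  rewrite /well_formed -/(topological gs2) sgs2 /=.
  by apply: (@topological_catl gs2 (drop j.+1 gs')); rewrite e2.
exists (Circuit wf); split.
- rewrite /circuit_poly /= -nth_last size_gate_scan sgs2 /=.
  by rewrite -(nth_gate_scan_cat _ _ (drop j.+1 gs')) ?sgs2 // e2; apply: v2.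
- apply/bigmax_leqP_seq => x /(nthP 0%N)[i]; rewrite /= size_gate_scan => lti <- _.
  by rewrite -(nth_gate_scan_cat _ _ (drop j.+1 gs')) // e2; apply: d1.
- apply: leq_trans e; apply: leq_trans (leq_trans e1 _) => //.
  by rewrite /circuit_size /= -e2 /edges big_cat leq_addr.
Qed.

Definition shift_gate m g : gate F n :=
  match g with
  | Const a => Const a
  | Var i => Var i
  | Add js => Add (map (addn m) js)
  | Mul js => Mul (map (addn m) js)
  end.

Lemma children_shift_gate m g : children (shift_gate m g) = map (addn m) (children g).
Proof. by case: g. Qed.

Lemma gate_scan_shift gs gs' : topological gs' ->
  gate_scan (@gate_poly F n) (gs ++ map (shift_gate (size gs)) gs') =
    gate_scan (@gate_poly F n) gs ++ gate_scan (@gate_poly F n) gs' /\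
  gate_scan (@gate_depth F n) (gs ++ map (shift_gate (size gs)) gs') =
    gate_scan (@gate_depth F n) gs ++ gate_scan (@gate_depth F n) gs'.
Proof.
elim/last_ind: gs' => [|gs' g IH]; first by rewrite /= !cats0.
rewrite topological_rcons => /andP[/IH[e1 e2] lg].
rewrite map_rcons -rcons_cat !gate_scan_rcons e1 e2 -!rcons_cat; split; congr (rcons _ _).
  case: g lg => //= js _; rewrite big_map; apply: eq_bigr => j _;
  by rewrite nth_cat size_gate_scan ltnNge leq_addr addKn.
rewrite /gate_depth children_shift_gate big_map; apply: eq_bigr => j _.
by rewrite nth_cat size_gate_scan ltnNge leq_addr addKn.
Qed.

Lemma topological_shift gs gs' : topological gs -> topological gs' ->
  topological (gs ++ map (shift_gate (size gs)) gs').
Proof.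
move=> t; elim/last_ind: gs' => [|gs' g IH]; first by rewrite cats0.
rewrite topological_rcons map_rcons -rcons_cat topological_rcons => /andP[/IH-> lg] /=.
rewrite children_shift_gate all_map; apply: sub_all lg => j /= lt.
by rewrite size_cat size_map ltn_add2l.
Qed.

Lemma step_circuit Q s D p : computable_by p D s -> step Q s (only D p).
Proof.
case=> -[gs' wf] [/= vp dp sp] gs t hQ; have /andP[sgs' t'] := wf.
have [e1 e2] := gate_scan_shift gs t'.
exists (map (shift_gate (size gs)) gs'); split; first exact: topological_shift.
  rewrite /edges big_map; under eq_bigr => g _ do rewrite children_shift_gate size_map.
  exact: sp.
move=> D' q [leD ->]; exists (size gs + (size gs').-1)%N; split.
- by rewrite size_cat size_map ltn_add2l prednK.
- rewrite /value_of e1 nth_cat size_gate_scan ltnNge leq_addr addKn -vp /circuit_poly /= -nth_last.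
  by rewrite size_gate_scan.
- rewrite /depth_of e2 nth_cat size_gate_scan ltnNge leq_addr addKn.
  apply: leq_trans leD; apply: leq_trans dp; rewrite /circuit_depth /=.
  have := @mem_nth _ 0%N (gate_scan (@gate_depth F n) gs') (size gs').-1.
  rewrite size_gate_scan prednK // leqnn => /(_ isT) m.
  by rewrite (big_rem _ m) leq_maxl.
Qed.

End GateLists.

Arguments only {F n}.
Arguments availU {F n}.

(** Evaluation, substitution and restriction to a line are all instances of [mmap]; this commutation
    is what relates them throughout. *)
Lemma rmorph_mmap (R S S' : comNzRingType) n (f : {rmorphism R -> S})
    (phi : {rmorphism S -> S'}) (h : 'I_n -> S) p :
  phi (mmap f h p) = mmap (fun c => phi (f c)) (fun i => phi (h i)) p.
Proof.
rewrite rmorph_sum; apply: eq_bigr => m _.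
rewrite rmorphM rmorph_prod; congr (_ * _).
by apply: eq_bigr => i _; rewrite rmorphXn.
Qed.

Lemma eq_mmap (R S : comNzRingType) n (f f' : R -> S) (h h' : 'I_n -> S) p :
  f =1 f' -> h =1 h' -> mmap f h p = mmap f' h' p.
Proof.
move=> ef eh; apply: eq_bigr => m _; rewrite ef; congr (_ * _).
by apply: eq_bigr => i _; rewrite eh.
Qed.

Lemma mmap_comp (R S : comNzRingType) n n' (f : {rmorphism R -> S})
    (h : 'I_n' -> S) (lq : n.-tuple {mpoly R[n']}) p :
  mmap f h (p \mPo lq) = mmap f (fun i => mmap f h (tnth lq i)) p.
Proof.
rewrite /comp_mpoly rmorph_mmap; apply: eq_mmap => //= c; exact: mmapC.
Qed.

Section Support.

Variables (F : fieldType) (n : nat) (S : comNzRingType) (f : {rmorphism F -> S}).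
Implicit Types (gs : seq (gate F n)).

Lemma mmap_gate_poly (h : 'I_n -> S) gs g :
  mmap f h (gate_poly (gate_scan (@gate_poly F n) gs) g) =
  match g with
  | Const c => f c
  | Var i => h i
  | Add js => \sum_(j <- js) mmap f h (value_of gs j)
  | Mul js => \prod_(j <- js) mmap f h (value_of gs j)
  end.
Proof.
case: g => [c|i|js|js] /=; first exact: mmapC.
- by rewrite mmapX mmap1U.
- by rewrite rmorph_sum.
- by rewrite rmorph_prod.
Qed.

(** Every child lies in [used], so the evaluation of a used gate only reaches variables at used
    positions. *)
Lemma mmap_value_agree (used : pred nat) (h h' : 'I_n -> S) gs :
  topological gs -> all (fun g => all used (children g)) gs ->
  (forall j i, used j -> (j < size gs)%N -> nth (Add [::]) gs j = Var i -> h i = h' i) ->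
  forall j, used j -> (j < size gs)%N ->
    mmap f h (value_of gs j) = mmap f h' (value_of gs j).
Proof.
elim/last_ind: gs => [//|gs g IH].
rewrite topological_rcons all_rcons => /andP[t lg] /andP[ug ugs] agree j uj.
have {}IH : forall j, used j -> (j < size gs)%N ->
    mmap f h (value_of gs j) = mmap f h' (value_of gs j).
  apply: IH => // i v ui lti e; apply: (agree i) => //; first by rewrite size_rcons ltnW.
  by rewrite nth_rcons lti.
rewrite size_rcons ltnS value_of_rcons leq_eqVlt; case: eqP => [ej _|_ /= lt]; last exact: IH.
rewrite !mmap_gate_poly; case: g lg ug agree => //= [i|js|js] lg ug agree.
- by apply: (agree j) => //; rewrite ?size_rcons ej ?ltnS // nth_rcons ltnn eqxx.
- by apply: eq_big_seq => i ijs; apply: IH; [apply: (allP ug)|apply: (allP lg)].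
- by apply: eq_big_seq => i ijs; apply: IH; [apply: (allP ug)|apply: (allP lg)].
Qed.

End Support.

Definition used_gates (F : fieldType) n (C : circuit F n) : seq nat :=
  (size (gates C)).-1 :: flatten (map (@children F n) (gates C)).

(* Size counts edges only, so a circuit may contain arbitrarily many unread
   variables; only those that are read cost anything when substituting. *)
Definition circuit_support (F : fieldType) n (C : circuit F n) : seq 'I_n :=
  pmap (fun j => if nth (Add [::]) (gates C) j is Var i then Some i else None)
       (used_gates C).

Lemma size_circuit_support (F : fieldType) n (C : circuit F n) :
  (size (circuit_support C) <= (circuit_size C).+1)%N.
Proof.
rewrite size_pmap (leq_trans (count_size _ _)) //= ltnS size_flatten /shape sumnE.
by rewrite !big_map.
Qed.

Lemma circuit_poly_value (F : fieldType) n (C : circuit F n) :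
  circuit_poly C = value_of (gates C) (size (gates C)).-1.
Proof. by rewrite /circuit_poly -nth_last size_gate_scan. Qed.

Lemma mmap_circuit_support (F : fieldType) n (C : circuit F n) (S : comNzRingType)
    (f : {rmorphism F -> S}) (h h' : 'I_n -> S) :
  {in circuit_support C, h =1 h'} ->
  mmap f h (circuit_poly C) = mmap f h' (circuit_poly C).
Proof.
move=> agree; have /andP[s0 t] := gates_wf C.
rewrite circuit_poly_value; apply: (@mmap_value_agree _ _ _ _ (mem (used_gates C))) => //.
- rewrite -(all_map _ (all _)); apply/allP => js jsr; apply/allP => j jjs.
  by rewrite /= in_cons; apply/orP; right; apply/flattenP; exists js.
- move=> j i uj lt e; apply: agree.
  by rewrite mem_pmap; apply/mapP; exists j => //; rewrite e.
- by rewrite /= mem_head.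
- by rewrite prednK.
Qed.

(** * Gate-by-gate computation of the coefficients modulo T^(N+1) *)

Section Simulation.

Variables (F : fieldType) (n : nat).
Hypothesis F0 : [pchar F] =i pred0.
Local Notation P := {mpoly F[n]}.
Implicit Type Q : avail F n.

(* The truncated factors have degree at most N, so their product is interpolated
   at size r * N + 1 points. *)
Lemma step_truncated_prod (I : eqType) (r : seq I) Q D N (q : I -> {poly P}) :
  (forall i j, i \in r -> (j <= N)%N -> Q D (q i)`_j) ->
  step Q (7 * N.+1 ^ 2 * size r ^ 2)
    (fun D' p => (D + 5 <= D')%N /\ exists2 j, (j <= N)%N & p = (\prod_(i <- r) q i)`_j).
Proof.
move=> Qq; case: (posnP (size r)) => [/size0nil ->|r_gt0].
  rewrite muln0; pose c (j : nat) : F := (j == 0)%:R.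
  have st := step_seq_const (r := iota 0 N.+1) (fun j _ => @step_const _ _ Q (D + 5) (c j)).
  apply: (stepW st) => //; first by rewrite muln0.
  move=> D' p [leD [j lej ->]]; exists j; first by rewrite mem_iota ltnS.
  by split=> //; rewrite big_nil coef1 /c rmorph_nat.
set m := size r in r_gt0 *.
have [w wP] := coef_interpolation F0 (m * N).
pose us := iota 0 (m * N).+1.
(* Truncation bounds the number of nodes and does not affect the coefficients up to N of the
   product. *)
pose tq i := take_poly N.+1 (q i).
have tqE i (u : nat) : (tq i).[u%:R] =
    \sum_(j <- iota 0 N.+1) (u%:R ^+ j)%:MP * (q i)`_j.
  rewrite (horner_coef_wide _ (size_take_poly _ _)) -[iota 0 _]/(index_iota 0 N.+1).
  rewrite big_mkord; apply: eq_bigr => j _.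
  by rewrite coef_take_poly ltn_ord mulrC rmorphXn /= rmorph_nat.
pose pairs := [seq (i, u) | i <- r, u <- us].
(* Five layers: values of the factors at all nodes (two), products at each node (one), recombination
   into coefficients (two). *)
pose R1 : avail F n := fun D' p => exists2 iu, iu \in pairs & only D.+2 (tq iu.1).[iu.2%:R] D' p.
have st1 : step Q (m * (m * N).+1 * (3 * N.+1)) R1.
  have -> : (m * (m * N).+1)%N = size pairs by rewrite size_allpairs size_iota.
  apply: step_seq_const => -[i u] /allpairsP[[i' u'] /= [ir _ [-> ->]]].
  rewrite tqE -[X in (3 * X)%N](size_iota 0); apply: step_lin => j.
  by rewrite mem_iota ltnS => /= lej; apply: Qq.
pose R2 : avail F n := fun D' p =>
  exists2 u, u \in us & only D.+3 (\prod_(i <- r) (tq i).[u%:R]) D' p.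
have st2 : step (availU Q R1) ((m * N).+1 * m) R2.
  rewrite -[X in (X * m)%N](size_iota 0); apply: step_seq_const => u uus.
  by apply: step_prod => i ir; right; exists (i, u) => //; apply: allpairs_f.
pose R3 : avail F n := fun D' p => exists2 j, j \in iota 0 N.+1 &
  only D.+3.+2 (\sum_(u <- us) (w j u)%:MP * \prod_(i <- r) (tq i).[u%:R]) D' p.
have st3 : step (availU Q (availU R1 R2)) (N.+1 * (3 * (m * N).+1)) R3.
  rewrite -[X in (X * (3 * _))%N](size_iota 0) -[X in (_ * (3 * X))%N](size_iota 0).
  apply: step_seq_const => j _.
  by apply: step_lin => u uus; right; right; exists u.
have stprod (s : seq I) : (size (\prod_(i <- s) tq i)%R <= (size s * N).+1)%N.
  elim: s => [|i s IH]; first by rewrite big_nil size_poly1.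
  rewrite big_cons (leq_trans (size_polyMleq _ _)) //= mulSn.
  rewrite -subn1 leq_subLR addnS -addnS -addSn add1n -addSn.
  have := leq_add (size_take_poly N.+1 (q i)) IH; rewrite -/(tq i).
  by rewrite addSn addnS.
(* The constant 7 is 3 + 1 + 3, one summand for each of the three steps. *)
apply: (stepW (step_trans (step_trans st1 st2) st3)) => //.
  have : ((m * N).+1 <= m * N.+1)%N by rewrite mulnS; lia.
  have : (0 < N.+1)%N by [].
  rewrite -!mulnn; move: {st1 st2 st3} (N.+1) ((m * N).+1) => X Y X0 leY.
  have e1 : (m * Y * (3 * X) <= 3 * (X * X * (m * m)))%N.
    by rewrite (leq_trans (leq_mul (leq_mul (leqnn m) leY) (leqnn _))) //; lia.
  have e2 : (Y * m <= X * X * (m * m))%N.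
    by rewrite (leq_trans (leq_mul leY (leqnn m))) //; nia.
  have e3 : (X * (3 * Y) <= 3 * (X * X * (m * m)))%N.
    rewrite mulnCA leq_mul2l /=.
    have h1 : (X * Y <= X * (m * X))%N by rewrite leq_mul.
    have h2 : (X * X * m <= X * X * (m * m))%N by rewrite leq_mul // leq_pmulr.
    by lia.
  lia.
move=> D' p [leD [j lej ->]]; right; exists j; first by rewrite mem_iota ltnS.
split; first by lia.
transitivity (\prod_(i <- r) tq i)`_j.
  elim: (r) j lej => [|i s IH] j lej; first by rewrite !big_nil.
  rewrite !big_cons; have := @eqTM _ N.+1 (q i) (tq i) (\prod_(i <- s) q i) (\prod_(i <- s) tq i).
  by apply => // b ltb; rewrite coef_take_poly ltb.
rewrite (wP _ _ (@mpolyC n F) _ (stprod r)) -[us]/(index_iota 0 (m * N).+1) big_mkord.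
by apply: eq_bigr => u _; rewrite horner_prod.
Qed.

(** A sum gate is simulated coefficientwise and a product gate by [step_truncated_prod]; both fit
    into five layers above the children, whose depth is at most [e.-1]. Gates without children are
    inputs or constants and add no edges. *)
Lemma step_gate_coefs n0 (gs : seq (gate F n0)) (g : gate F n0) (h : 'I_n0 -> {poly P}) Q D N e :
  (forall v j D', (j <= N)%N -> (D <= D')%N -> Q D' (h v)`_j) ->
  (forall i j D', i \in children g -> (j <= N)%N -> (D + 5 * depth_of gs i <= D')%N ->
     Q D' (mmap (polyC \o @mpolyC n F) h (value_of gs i))`_j) ->
  e = gate_depth (gate_scan (@gate_depth F n0) gs) g ->
  step Q (7 * N.+1 ^ 2 * size (children g) ^ 2) (fun D' p =>
    exists2 j, (j <= N)%N & (D + 5 * e <= D')%N /\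
      p = (mmap (polyC \o @mpolyC n F) h (gate_poly (gate_scan (@gate_poly F n0) gs) g))`_j).
Proof.
move=> Qh Qc ee.
have constant a : (forall j, (mmap (polyC \o @mpolyC n F) h
    (gate_poly (gate_scan (@gate_poly F n0) gs) g))`_j = (a j)%:MP) ->
    step Q (7 * N.+1 ^ 2 * size (children g) ^ 2) (fun D' p =>
    exists2 j, (j <= N)%N & (D + 5 * e <= D')%N /\
      p = (mmap (polyC \o @mpolyC n F) h (gate_poly (gate_scan (@gate_poly F n0) gs) g))`_j).
  move=> ca; have st := step_seq_const (r := iota 0 N.+1)
    (fun j _ => @step_const _ _ Q (D + 5 * e) (a j)).
  apply: (stepW st) => //; first by rewrite muln0.
  by move=> D' p [j lej [leD ->]]; exists j; rewrite ?mem_iota ?ltnS //; split=> //; rewrite ca.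
have [c0|c_gt0] := posnP (size (children g)).
  case: g c0 {Qc} ee constant => [c|v|js|js] c0 ee constant.
  - apply: (constant (fun j => if (j == 0)%N then c else 0)) => j.
    by rewrite mmap_gate_poly /= coefC; case: eqP => _ //; rewrite mpolyC0.
  - apply: (stepW (@step0 _ _ Q Q _)) => //.
    by move=> D' p [j lej [leD ->]]; rewrite mmap_gate_poly; apply: Qh => //; lia.
  - move/size0nil: c0 => /= c0; subst js; apply: (constant (fun=> 0)) => j.
    by rewrite mmap_gate_poly big_nil coef0 mpolyC0.
  - move/size0nil: c0 => /= c0; subst js; apply: (constant (fun j => (j == 0%N)%:R)) => j.
    by rewrite mmap_gate_poly big_nil coef1 rmorph_nat.
have cd i : i \in children g -> (depth_of gs i <= e.-1)%N.
  by move=> ig; have := child_depth gs ig; rewrite -ee; case: (e).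
have e_gt0 : (0 < e)%N.
  by case: (children g) (child_depth (g := g) gs) c_gt0 => // i js /(_ i (mem_head _ _)); rewrite -ee; lia.
have Qc' i j D' : i \in children g -> (j <= N)%N -> (D + 5 * e.-1 <= D')%N ->
     Q D' (mmap (polyC \o @mpolyC n F) h (value_of gs i))`_j.
  by move=> ig lej leD; apply: Qc => //; have := cd i ig; lia.
case: g ee c_gt0 {Qc constant cd} Qc' => [//|//|js|js] /= ee c_gt0 Qc.
- pose q i := mmap (polyC \o @mpolyC n F) h (value_of gs i).
  have st : step Q (size (iota 0 N.+1) * size js) (fun D' p => exists2 j, j \in iota 0 N.+1 &
      only (D + 5 * e.-1).+1 (\sum_(i <- js) (q i)`_j) D' p).
    apply: step_seq_const => j; rewrite mem_iota ltnS => /= lej.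
    by apply: step_sum => i ijs; apply: Qc.
  apply: (stepW st) => //.
    rewrite size_iota -!mulnn -mulnA -[leqLHS]mul1n leq_mul //.
    by rewrite leq_mul // leq_pmulr.
  move=> D' p [j lej [leD ->]]; exists j; first by rewrite mem_iota ltnS.
  split; first by lia.
  by rewrite (mmap_gate_poly _ _ _ (Add js)) coef_sum.
- have st := @step_truncated_prod _ js Q (D + 5 * e.-1) N
    (fun i => mmap (polyC \o @mpolyC n F) h (value_of gs i)).
  apply: (stepW (st _)) => //.
    by move=> i j ijs lej; apply: Qc.
  move=> D' p [j lej [leD ->]]; split; first by lia.
  by exists j; rewrite // (mmap_gate_poly _ _ _ (Mul js)).
Qed.

Lemma step_simulation n0 (gs : seq (gate F n0)) (h : 'I_n0 -> {poly P}) Q D N :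
  topological gs ->
  (forall v j D', (j <= N)%N -> (D <= D')%N -> Q D' (h v)`_j) ->
  step Q (\sum_(g <- gs) 7 * N.+1 ^ 2 * size (children g) ^ 2) (fun D' p =>
    exists i j, [/\ (i < size gs)%N, (j <= N)%N, (D + 5 * depth_of gs i <= D')%N
      & p = (mmap (polyC \o @mpolyC n F) h (value_of gs i))`_j]).
Proof.
move=> t Qh; elim/last_ind: gs t => [_|gs g IH].
  by rewrite big_nil; apply: step0 => D' p [i [j []]].
rewrite topological_rcons => /andP[/IH st lg]; rewrite -cats1 big_cat big_seq1 /=.
set R := (X in step _ _ X) in st.
pose e := gate_depth (gate_scan (@gate_depth F n0) gs) g.
have st2 := @step_gate_coefs n0 gs g h (availU Q R) D N e.
apply: (stepW (step_trans st (st2 _ _ (erefl _)))) => //.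
- by move=> v j D' lej leD; left; apply: Qh.
- move=> i j D' ig lej leD; right; exists i, j; split=> //; exact: (allP lg).
move=> D' p [i [j []]]; rewrite cats1 size_rcons ltnS value_of_rcons depth_of_rcons.
case: eqP => [-> _ lej leD ->|/eqP ne lei lej leD ->].
  by right; exists j.
by left; exists i, j; split=> //; rewrite ltn_neqAle ne.
Qed.

Lemma sum_sqr_le (I : Type) (r : seq I) (c : I -> nat) :
  (\sum_(i <- r) c i ^ 2 <= (\sum_(i <- r) c i) ^ 2)%N.
Proof.
elim: r => [|i r IH]; first by rewrite !big_nil.
by rewrite !big_cons sqrnD; move: IH; lia.
Qed.

Lemma step_circuit_coefs n0 (C : circuit F n0) Delta s (h : 'I_n0 -> {poly P}) Q D s0 N :
  (circuit_depth C <= Delta)%N -> (circuit_size C <= s)%N ->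
  (forall v j, (j <= N)%N -> computable_by (h v)`_j D s0) ->
  step Q (s.+1 * N.+1 * s0 + 7 * N.+1 ^ 2 * s ^ 2) (fun D' p =>
    exists2 j, (j <= N)%N & (D + 5 * Delta <= D')%N /\
      p = (mmap (polyC \o @mpolyC n F) h (circuit_poly C))`_j).
Proof.
move=> dC sC ch; pose U := circuit_support C.
(* Inputs that are never read are replaced by zero, so at most s + 1 inputs have to be computed; the
   constant gate in [st3] supplies the coefficients of the others. *)
pose h' v := if v \in U then h v else 0.
rewrite (@mmap_circuit_support _ _ C _ (polyC \o @mpolyC n F) h h'); last first.
  by move=> v vU; rewrite /h' vU.
pose vs := [seq (v, j) | v <- U, j <- iota 0 N.+1].
have st1 : step Q (size vs * s0) (fun D' p => exists2 vj, vj \in vs & only D (h vj.1)`_vj.2 D' p).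
  apply: step_seq_const => -[v j] /allpairsP[[v' j'] [_ + [-> ->]]].
  by rewrite mem_iota ltnS => lej; apply: step_circuit; apply: ch.
have st3 := step_trans st1 (@step_const _ _ _ D 0).
have /andP[s_gt0 t] := gates_wf C.
set R1 := (X in step _ _ X) in st3.
have st4 := @step_simulation n0 (gates C) h' (availU Q R1) D N t.
apply: (stepW (step_trans st3 (st4 _))) => //.
- move=> v j D' lej leD; right; rewrite /h'; case: ifP => vU; last first.
    by right; rewrite coef0 mpolyC0.
  left; exists (v, j) => //; apply/allpairsP; exists (v, j); split=> //.
  by rewrite mem_iota ltnS.
- rewrite addn0 leq_add //.
    rewrite size_allpairs size_iota !leq_mul // (leq_trans (size_circuit_support _)) //.
  (* The cost of a gate is quadratic in its fan-in, and the squares of the fan-ins sum to at most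
     the square of the number of edges. *)
  rewrite -big_distrr /= leq_mul // (leq_trans (sum_sqr_le _ _)) //.
  by rewrite leq_exp2r.
move=> D' p [j lej [leD ->]]; right; exists (size (gates C)).-1, j; split.
- by rewrite prednK.
- exact: lej.
- apply: leq_trans leD; rewrite leq_add2l leq_mul // (leq_trans _ dC) //.
  have m : depth_of (gates C) (size (gates C)).-1 \in gate_scan (@gate_depth F n0) (gates C).
    by apply: mem_nth; rewrite size_gate_scan prednK.
  by rewrite /circuit_depth (big_rem _ m) leq_maxl.
- by rewrite circuit_poly_value.
Qed.

End Simulation.

(** * Evaluation points *)

Section Points.

Variable n : nat.

Definition cons_pt T (t : T) (x : 'I_n -> T) : 'I_n.+1 -> T :=
  fun i => if unlift ord0 i is Some j then x j else t.

Definition rcons_pt T (x : 'I_n -> T) (z : T) : 'I_n.+1 -> T :=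
  fun i => if unlift ord_max i is Some j then x j else z.

Lemma cons_pt0 T (t : T) x : cons_pt t x ord0 = t.
Proof. by rewrite /cons_pt unlift_none. Qed.

Lemma cons_pt_lift T (t : T) x i : cons_pt t x (lift ord0 i) = x i.
Proof. by rewrite /cons_pt liftK. Qed.

Lemma rcons_pt_max T x (z : T) : rcons_pt x z ord_max = z.
Proof. by rewrite /rcons_pt unlift_none. Qed.

Lemma rcons_pt_lift T x (z : T) i : rcons_pt x z (lift ord_max i) = x i.
Proof. by rewrite /rcons_pt liftK. Qed.

Lemma eq_cons_pt T (t t' : T) x x' : t = t' -> x =1 x' -> cons_pt t x =1 cons_pt t' x'.
Proof. by move=> -> e i; rewrite /cons_pt; case: unlift. Qed.

Lemma eq_rcons_pt T (z z' : T) x x' : x =1 x' -> z = z' -> rcons_pt x z =1 rcons_pt x' z'.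
Proof. by move=> e -> i; rewrite /rcons_pt; case: unlift. Qed.

End Points.

(** * Polynomial identities checked at points *)

Section Evaluation.

Variable F : fieldType.
Hypothesis F0 : [pchar F] =i pred0.

Lemma poly_eq0_horner (p : {poly F}) : (forall x, p.[x] = 0) -> p = 0.
Proof.
move=> p0; apply/polyP => i; have [w wP] := coef_interpolation F0 (size p).
by rewrite (wP _ _ idfun p (leqnSn _)) big1 ?coef0 // => b _; rewrite p0 mulr0.
Qed.

(** Induction on the number of variables: [q] is p as a univariate polynomial in its first variable,
    its coefficients vanish at every point, and [phi] puts the variables back. *)
Lemma mpoly_eq0_eval n (p : {mpoly F[n]}) : (forall v, p.@[v] = 0) -> p = 0.
Proof.
elim: n p => [|n IH] p p0.
  rewrite (nvar0_mpolyC p) in p0 *.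
  by have := p0 (fun=> 0); rewrite mevalC => ->; rewrite mpolyC0.
pose h : 'I_n.+1 -> {poly {mpoly F[n]}} := cons_pt 'X (fun j => ('X_j)%:P).
pose q := mmap (polyC \o @mpolyC n F) h p.
have q0 : q = 0.
  apply/polyP => i; rewrite coef0; apply: IH => v.
  rewrite -[_.@[v]]/(meval v _) -coef_map /=.
  have -> : map_poly (meval v) q = 0; last by rewrite coef0.
  apply: poly_eq0_horner => x.
  rewrite -[_.[x]]/((horner_eval x \o map_poly (meval v)) q) rmorph_mmap.
  rewrite -[RHS](p0 (fun i => (map_poly (meval v) (h i)).[x])).
  apply: eq_mmap => //= c.
  by rewrite map_polyC /= mevalC /horner_eval hornerC.
pose phi := horner_eval ('X_ord0 : {mpoly F[n.+1]}) \o
  map_poly (mmap (@mpolyC n.+1 F) (fun j : 'I_n => 'X_(lift ord0 j))).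
have : phi q = p.
  rewrite /phi [LHS]rmorph_mmap -[RHS]comp_mpoly_id; apply: eq_mmap => [c|i] /=.
    by rewrite map_polyC /= mmapC /horner_eval hornerC.
  rewrite tnth_mktuple /h /cons_pt; case: unliftP => [j ->|->].
    by rewrite map_polyC /= mmapX mmap1U /horner_eval hornerC.
  by rewrite map_polyX /horner_eval hornerX.
by rewrite /phi q0 rmorph0 => <-.
Qed.

Lemma mpoly_eq_eval n (p q : {mpoly F[n]}) : (forall v, p.@[v] = q.@[v]) -> p = q.
Proof.
move=> e; apply/eqP; rewrite -subr_eq0; apply/eqP/mpoly_eq0_eval => v.
by rewrite mevalB e subrr.
Qed.

(** Degrees multiply under composition: if p were not constant, a would be a nonzero constant, and
    so would the composition. *)
Lemma algebraic_poly_const (a p : {poly F}) : a != 0 -> a \Po p = 0 -> (size p <= 1)%N.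
Proof.
move=> a0 ap; have := size_comp_poly a p; rewrite ap size_poly0 /= => /esym/eqP.
rewrite muln_eq0 => /orP[/eqP sa|/eqP sp]; last by move: sp; case: (size p) => [|[]].
have sa1 : size a = 1%N.
  by move: sa; have := a0; rewrite -size_poly_gt0; case: (size a) => [|[]].
have /size_poly1P[c c0 ec] : size a == 1%N by rewrite sa1.
by move: ap; rewrite ec comp_polyC => /eqP; rewrite polyC_eq0 (negPf c0).
Qed.

Lemma deriv_mmap n (i0 : 'I_n) (y : 'I_n -> F) (p : {mpoly F[n]}) :
  let h i := if i == i0 then 'X else (y i)%:P in
  (mmap (@polyC F) h p)^`() = mmap (@polyC F) h p^`M(i0).
Proof.
move=> h.
have hX m : mmap1 h m = (\prod_(i < n | i != i0) y i ^+ m i)%:P * 'X^(m i0).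
  rewrite /mmap1 (bigD1 i0) //= {1}/h eqxx mulrC rmorph_prod; congr (_ * _).
  by apply: eq_bigr => i ne; rewrite /h (negPf ne) rmorphXn.
elim/mpolyind: p => [|c m p _ _ IH]; first by rewrite mderiv0 !mmap0 deriv0.
rewrite mderivD mderivZ mderivX !mmapD derivD IH; congr (_ + _).
rewrite !mmapZ !mmapX !hX rmorph_nat !deriv_mulC derivXn.
have -> : \prod_(i < n | i != i0) y i ^+ (m - U_(i0))%MM i = \prod_(i < n | i != i0) y i ^+ m i.
  by apply: eq_bigr => i ne; rewrite mnmBE mnm1E eq_sym (negPf ne) subn0.
by rewrite mnmBE mnm1E eqxx subn1 -mulr_natl; ring.
Qed.

End Evaluation.

Section Substitution.

Variables (F : fieldType) (n : nat) (S : comNzRingType) (f : {rmorphism F -> S}).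

Lemma mmap_subst_z (A : {mpoly F[n.+2]}) Phi (h : 'I_n.+1 -> S) :
  mmap f h (subst_z A Phi) = mmap f (rcons_pt h (mmap f h Phi)) A.
Proof.
rewrite mmap_comp; apply: eq_mmap => // i.
by rewrite tnth_mktuple /rcons_pt; case: unlift => // j; rewrite mmapX mmap1U.
Qed.

Lemma mmap_subst_T0 (A : {mpoly F[n.+2]}) (h : 'I_n.+2 -> S) :
  mmap f h (subst_T0 A) = mmap f (fun i => if i == ord0 then 0 else h i) A.
Proof.
rewrite mmap_comp; apply: eq_mmap => // i.
by rewrite tnth_mktuple; case: eqP => _; rewrite ?mmap0 ?mmapX ?mmap1U.
Qed.

Lemma mmap_T_regularized (A : {mpoly F[n.+2]}) a (x : 'I_n -> S) z :
  subst_T0 A = (map_poly (@mpolyC n.+2 F) a).['X_ord_max] ->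
  mmap f (rcons_pt (cons_pt 0 x) z) A = (map_poly f a).[z].
Proof.
move=> e; pose h := rcons_pt (cons_pt 0 x) z.
have -> : mmap f h A = mmap f h (subst_T0 A).
  rewrite mmap_subst_T0; apply: eq_mmap => // i; case: eqP => // ->.
  have -> : ord0 = lift ord_max ord0 :> 'I_n.+2 by apply: val_inj.
  by rewrite /h rcons_pt_lift cons_pt0.
rewrite e -horner_map /= mmapX mmap1U /h rcons_pt_max -map_poly_comp.
by congr (_.[_]); apply: eq_map_poly => c /=; apply: mmapC.
Qed.

End Substitution.

(** * Costs of the basic operations on computable polynomials *)

Section Combinators.

Variables (F : fieldType) (n : nat).
Local Notation P := {mpoly F[n]}.

Lemma computableW (p : P) D D' s s' : computable_by p D s -> (D <= D')%N -> (s <= s')%N ->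
  computable_by p D' s'.
Proof. by case=> C [e d z] lD ls; exists C; split=> //; [apply: leq_trans lD|apply: leq_trans ls]. Qed.

Lemma computable_const c D s : computable_by (c%:MP : P) D s.
Proof. by apply: (computableW (step_computable (@step_const F n _ D c))). Qed.

Lemma computable_var i D s : computable_by ('X_i : P) D s.
Proof. by apply: (computableW (step_computable (@step_var F n _ D i))). Qed.

Lemma computable_lin (I : finType) (a : I -> F) (x : I -> P) D s :
  (forall i, computable_by (x i) D s) ->
  computable_by (\sum_i (a i)%:MP * x i) D.+2 (#|I| * (s + 3)).
Proof.
move=> cx; apply: step_computable.
have st1 := step_seq_const (r := enum I)
  (fun i _ => @step_circuit _ _ (fun _ _ => False) _ _ _ (cx i)).
rewrite -big_enum cardE mulnDr [(_ * 3)%N]mulnC.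
apply: (stepW (step_trans st1 (@step_lin _ _ _ (enum I) _ D a x _))) => //.
  by move=> i ie; right; exists i.
by move=> D' p; right.
Qed.

Lemma computable_prod (I : finType) (x : I -> P) D s :
  (forall i, computable_by (x i) D s) ->
  computable_by (\prod_i x i) D.+1 (#|I| * (s + 1)).
Proof.
move=> cx; apply: step_computable.
have st1 := step_seq_const (r := enum I)
  (fun i _ => @step_circuit _ _ (fun _ _ => False) _ _ _ (cx i)).
rewrite -big_enum cardE mulnDr muln1.
apply: (stepW (step_trans st1 (@step_prod _ _ _ (enum I) _ D x _))) => //.
  by move=> i ie; right; exists i.
by move=> D' p; right.
Qed.

Lemma computable_addC c (p : P) D s : computable_by p D s ->
  computable_by (c%:MP + p) D.+1 (s + 2).
Proof.
move=> cp; apply: step_computable.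
have st1 := @step_circuit _ _ (fun _ _ => False) _ _ _ cp.
have st2 := @step_const _ _ (availU (fun _ _ => False) (only D p)) D c.
have -> : c%:MP + p = \sum_(q <- [:: c%:MP; p]) id q by rewrite !big_cons big_nil addr0.
apply: (stepW (step_trans (step_trans st1 st2) (@step_sum _ _ _ [:: c%:MP; p] _ D id _))).
- move=> q; rewrite !inE => /orP[]/eqP->; right; first by right.
  by left.
- by [].
- by rewrite addn0.
- by move=> D' q; right.
Qed.

Lemma computable_exp m (p : P) D s : computable_by p D s ->
  computable_by (p ^+ m) D.+1 (s + m).
Proof.
move=> cp; apply: step_computable.
have st1 := @step_circuit _ _ (fun _ _ => False) _ _ _ cp.
have -> : p ^+ m = \prod_(i <- iota 0 m) p.
  by rewrite big_const_seq count_predT size_iota -Monoid.iteropE.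
rewrite -[m in (s + m)%N](size_iota 0).
apply: (stepW (step_trans st1 (@step_prod _ _ _ (iota 0 m) _ D (fun=> p) _))) => //.
  by move=> i _; right.
by move=> D' q; right.
Qed.

(** The case N = 0 of [step_circuit_coefs] with inputs constant in T; the factor 5 in the depth
    comes from there. *)
Lemma computable_subst n0 (C : circuit F n0) Delta s (X : 'I_n0 -> P) D s0 :
  [pchar F] =i pred0 -> (circuit_depth C <= Delta)%N -> (circuit_size C <= s)%N ->
  (forall v, computable_by (X v) D s0) ->
  computable_by (mmap (@mpolyC n F) X (circuit_poly C)) (D + 5 * Delta)
    (s.+1 * s0 + 7 * s ^ 2).
Proof.
move=> F0 dC sC cX; apply: step_computable.
have st := @step_circuit_coefs F n F0 n0 C Delta s (polyC \o X) (fun _ _ => False) D s0 0 dC sC.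
apply: (stepW (st _)) => //.
- by move=> v j; rewrite leqn0 => /eqP -> /=; rewrite coefC eqxx; apply: cX.
- by rewrite !muln1.
move=> D' p [leD ->]; exists 0%N => //; split=> //.
rewrite -[RHS]/((mmap (polyC \o @mpolyC n F) (polyC \o X) (circuit_poly C))`_0).
have := @rmorph_mmap _ _ _ n0 (@mpolyC n F) (@polyC P) X (circuit_poly C).
move=> e; rewrite -(_ : (mmap (@mpolyC n F) X (circuit_poly C))%:P =
  mmap (polyC \o @mpolyC n F) (polyC \o X) (circuit_poly C)) ?coefC //.
Qed.

End Combinators.

(** * Circuits for approximate roots *)

Section ApproximateRoot.

Variables (F : fieldType) (n k : nat) (A : {mpoly F[n.+2]}) (Phi : {mpoly F[n.+1]}).
Hypotheses (F0 : [pchar F] =i pred0) (k_gt0 : (0 < k)%N).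
Hypotheses (regA : T_regularized A) (rootA : approx_root k A Phi).
Hypotheses (truncPhi : truncated k Phi) (ndA : non_degenerate A Phi).

Definition root_base : F := Phi.@[fun=> 0].

Definition root_slope : F :=
  A^`M(ord_max).@[fun i => if i == ord_max then root_base else 0].

(* A(T, x, Phi(0, 0) + z), where T is the inner variable and z the outer one. *)
Definition shifted_at (x : 'I_n -> F) : {poly {poly F}} :=
  mmap (polyC \o @polyC F)
    (rcons_pt (cons_pt 'X%:P (fun j => (x j)%:P%:P)) (root_base%:P%:P + 'X)) A.

Definition root_at (x : 'I_n -> F) : {poly F} :=
  mmap (@polyC F) (cons_pt 'X (polyC \o x)) Phi.

Lemma mmap_root_vanishes (S : comNzRingType) (f : {rmorphism F -> S}) h :
  h ord0 = 0 -> mmap f (rcons_pt h (mmap f h Phi)) A = 0.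
Proof.
case: rootA => Q e h0.
rewrite -mmap_subst_z e rmorphM rmorphXn /= mmapX mmap1U h0.
by rewrite expr0n eqn0Ngt k_gt0 mulr0.
Qed.

(** [a] is A(0, x, z), which does not involve x. Since A(T, x, Phi) vanishes at T = 0, Phi(0, 0) is
    a root of it, and non-degeneracy says that this root is simple. *)
Lemma regularized_data : exists a : {poly F},
  [/\ a.[root_base] = 0, a^`().[root_base] = root_slope
    & forall (S : comNzRingType) (f : {rmorphism F -> S}) (x : 'I_n -> S) z,
      mmap f (rcons_pt (cons_pt 0 x) z) A = (map_poly f a).[z]].
Proof.
case: regA => a ea; have ev := mmap_T_regularized _ _ _ ea; exists a; split.
- have := ev _ idfun (fun=> 0) root_base; rewrite /= map_poly_id // => <-.
  rewrite -[RHS](@mmap_root_vanishes _ idfun (fun=> 0)) //.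
  apply: eq_mmap => //; apply: eq_rcons_pt => // i.
  by rewrite /cons_pt; case: unlift.
- pose h (i : 'I_n.+2) : {poly F} := if i == ord_max then 'X else (0 : F)%:P.
  have eh : rcons_pt (cons_pt 0 (fun=> 0)) 'X =1 h.
    move=> i; rewrite /rcons_pt /h; case: unliftP => [j ->|->]; last by rewrite eqxx.
    rewrite eq_sym (negPf (neq_lift _ _)) /cons_pt; case: unlift => //.
  have := ev _ (@polyC F) (fun=> 0) 'X.
  rewrite (eq_mmap _ (fun=> erefl) eh) -[(map_poly _ a).['X]]/(a \Po 'X) comp_polyXr => <-.
  rewrite (deriv_mmap ord_max (fun=> 0)) /root_slope /meval.
  rewrite -[LHS]/(horner_eval root_base _) rmorph_mmap.
  apply: eq_mmap => [c|i] /=; first by rewrite /horner_eval hornerC.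
  by rewrite /horner_eval; case: eqP => _; rewrite ?hornerX ?hornerC.
- by move=> S f x z; apply: ev.
Qed.

(** Along the line s x, the polynomial Phi(0, s x) is a root of the nonzero univariate [a] and hence
    constant in s. So one and the same shift centres the root at zero for every x. *)
Lemma root_constant_at_T0 (x : 'I_n -> F) : Phi.@[cons_pt 0 x] = root_base.
Proof.
have [a [_ a1 ev]] := regularized_data.
pose h : 'I_n.+1 -> {poly F} := cons_pt 0 (fun j => x j *: 'X).
pose p := mmap (@polyC F) h Phi.
have ap : a \Po p = 0.
  rewrite -[RHS](@mmap_root_vanishes _ (@polyC F) h) ?/h ?cons_pt0 //.
  by rewrite ev.
have a0 : a != 0.
  by apply/eqP => a0; move: ndA; rewrite /non_degenerate -/root_slope -a1 a0 deriv0 horner0 eqxx.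
have /size1_polyC pE := algebraic_poly_const a0 ap.
have pev s : p.[s] = Phi.@[cons_pt 0 (fun j => s * x j)].
  rewrite -[LHS]/(horner_eval s p) rmorph_mmap.
  apply: eq_mmap => [c|i] /=; first by rewrite /horner_eval hornerC.
  by rewrite /horner_eval /h /cons_pt; case: unlift => [j|]; rewrite ?hornerE ?horner0 1?mulrC.
have -> : Phi.@[cons_pt 0 x] = p.[1].
  by rewrite pev; apply: meval_eq; apply: eq_cons_pt => // j; rewrite mul1r.
have -> : root_base = p.[0].
  rewrite pev; apply: meval_eq => i; rewrite /cons_pt; case: unlift => // j.
  by rewrite mul0r.
by rewrite pE !hornerC.
Qed.

Lemma horner_shifted_at x (q : {poly F}) : (shifted_at x).[q] =
  mmap (@polyC F) (rcons_pt (cons_pt 'X (polyC \o x)) (root_base%:P + q)) A.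
Proof.
rewrite -[LHS]/(horner_eval q _) rmorph_mmap.
apply: eq_mmap => [c|i] /=; first by rewrite /horner_eval hornerC.
rewrite /horner_eval /rcons_pt /cons_pt.
case: unlift => [j|]; last by rewrite hornerD hornerC hornerX.
by case: unlift => [j'|]; rewrite hornerC.
Qed.

Lemma coef0_shifted_at x i : exists2 a : {poly F},
    (shifted_at x)`_i`_0 = (a \Po ('X + root_base%:P))`_i
  & a.[root_base] = 0 /\ a^`().[root_base] = root_slope.
Proof.
have [a [a0 a1 ev]] := regularized_data; exists a => //.
rewrite -horner_coef0 -[LHS]/(horner_eval 0 _) -coef_map /=.
congr (nth _ (polyseq _) _); rewrite addrC -[RHS](ev _ (@polyC F) (polyC \o x)).
rewrite rmorph_mmap.
apply: eq_mmap => [c|j] /=; first by rewrite map_polyC /= /horner_eval hornerC.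
rewrite /rcons_pt /cons_pt; case: unlift => [j'|]; last first.
  by rewrite rmorphD /= map_polyX map_polyC /= /horner_eval hornerC.
case: unlift => [j''|]; rewrite map_polyC /= /horner_eval ?hornerC //.
by rewrite hornerX.
Qed.

Lemma shifted_at00 x : (shifted_at x)`_0`_0 = 0.
Proof.
have [a -> [a0 _]] := coef0_shifted_at x 0.
by rewrite -horner_coef0 horner_comp hornerD hornerX hornerC add0r.
Qed.

Lemma shifted_at10 x : (shifted_at x)`_1`_0 = root_slope.
Proof.
have [a -> [_ a1]] := coef0_shifted_at x 1.
have := coef_deriv (a \Po ('X + root_base%:P)) 0; rewrite mulr1n => <-.
rewrite -horner_coef0 deriv_comp derivD derivX derivC addr0 mulr1.
by rewrite horner_comp hornerD hornerX hornerC add0r.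
Qed.

Lemma root_at_coef0 x : (root_at x)`_0 = root_base.
Proof.
rewrite -horner_coef0 -(root_constant_at_T0 x) -[LHS]/(horner_eval 0 _) rmorph_mmap.
apply: eq_mmap => [c|i] /=; first by rewrite /horner_eval hornerC.
by rewrite /horner_eval /cons_pt; case: unlift => [j|]; rewrite ?hornerC ?hornerX.
Qed.

Lemma horner_root_at x t : (root_at x).[t] = Phi.@[cons_pt t x].
Proof.
rewrite -[LHS]/(horner_eval t _) rmorph_mmap.
apply: eq_mmap => [c|i] /=; first by rewrite /horner_eval hornerC.
by rewrite /horner_eval /cons_pt; case: unlift => [j|]; rewrite ?hornerC ?hornerX.
Qed.

Lemma size_root_at x : (size (root_at x) <= k)%N.
Proof.
rewrite /root_at /mmap (leq_trans (size_sum _ _ _)) //.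
apply/bigmax_leqP_seq => m mPhi _.
rewrite mul_polyC (leq_trans (size_scale_leq _ _)) //.
rewrite /mmap1 big_ord_recl cons_pt0.
have -> : \prod_(i < n) cons_pt 'X (polyC \o x) (lift ord0 i) ^+ m (lift ord0 i) =
   (\prod_(i < n) x i ^+ m (lift ord0 i))%:P.
  by rewrite rmorph_prod; apply: eq_bigr => i _; rewrite cons_pt_lift rmorphXn.
rewrite mulrC mul_polyC (leq_trans (size_scale_leq _ _)) // size_polyXn.
exact: truncPhi.
Qed.

Lemma root_at_approx x : eqT k (shifted_at x).[root_at x - root_base%:P] 0.
Proof.
case: rootA => Q e j ltj; rewrite horner_shifted_at addrC subrK -mmap_subst_z e.
by rewrite rmorphM rmorphXn /= mmapX mmap1U cons_pt0 coefMXn ltj coef0.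
Qed.

End ApproximateRoot.

(** The number of triples (m, u, eta) in [approximate_root_value] with E + 1 = 3k, times the cost of
    one summand: the 3k coefficients, their combination, an added constant, a power and a scaling.
    The last 2 adds Phi(0, 0). *)
Definition root_cost (k s s0 : nat) : nat :=
  (2 * k * (3 * k * (2 * k)).+1 * (3 * k).+1 *
   (s.+1 * (3 * k) * s0 + 7 * (3 * k) ^ 2 * s ^ 2 + 3 * (3 * k) + 2 + 2 * k + 3) + 2)%N.

Section RootCircuit.

Variables (F : fieldType) (n n0 k Delta s D s0 : nat).
Variables (A : {mpoly F[n.+2]}) (Phi : {mpoly F[n.+1]}) (X : 'I_n -> {mpoly F[n0]}).
Hypotheses (F0 : [pchar F] =i pred0) (k_gt0 : (0 < k)%N).
Hypotheses (compA : computable_by A Delta s) (compX : forall j, computable_by (X j) D s0).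
Local Notation P := {mpoly F[n0]}.

Definition shifted_input (phi0 : F) (eta : nat) : 'I_n.+2 -> {poly P} :=
  rcons_pt (cons_pt 'X (fun j => (X j)%:P)) (phi0%:MP%:P + eta%:R%:P * 'X).

Definition shifted_coef phi0 eta j : P :=
  (mmap (polyC \o @mpolyC n0 F) (shifted_input phi0 eta) A)`_j.

(** The base of the powers in [approximate_root_value], with [rho eta] the truncation modulo
    T^(3k). *)
Definition shifted_affine phi0 (alpha : F) eta u : P :=
  (eta%:R * u%:R)%:MP +
  \sum_(j < 3 * k) (- alpha^-1 * u%:R ^+ j)%:MP * shifted_coef phi0 eta j.

Lemma computable_shifted_affine phi0 alpha eta u :
  computable_by (shifted_affine phi0 alpha eta u) (D + 5 * Delta + 3)
    (s.+1 * (3 * k) * s0 + 7 * (3 * k) ^ 2 * s ^ 2 + 3 * (3 * k) + 2).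
Proof.
rewrite addnS; apply: computable_addC; apply: step_computable.
case: compA => C [eC dC sC].
have N1 : (3 * k).-1.+1 = (3 * k)%N by rewrite prednK // muln_gt0.
have := @step_circuit_coefs F n0 F0 _ C Delta s (shifted_input phi0 eta) (fun _ _ => False) D s0
  (3 * k).-1 dC sC.
rewrite eC N1 => st.
rewrite -big_enum -[X in (_ + 3 * X)%N]card_ord cardE addn2.
apply: (stepW (step_trans (st _) (@step_lin _ _ _ (enum 'I_(3 * k)) _ (D + 5 * Delta)
  (fun j => - alpha^-1 * u%:R ^+ j) (fun j => shifted_coef phi0 eta j) _))) => //.
- move=> v j _; rewrite /shifted_input /rcons_pt /cons_pt; case: unlift => [i|]; last first.
    rewrite coefD coefC coefCM coefX; case: eqP => _;
    rewrite -(rmorph_nat (@mpolyC n0 F)) -?(rmorph_nat (@mpolyC n0 F) (j == 1%N));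
    rewrite -?rmorphM -?rmorphD ?add0r; exact: computable_const.
  case: unlift => [i'|]; last first.
    by rewrite coefX -(rmorph_nat (@mpolyC n0 F)); apply: computable_const.
  rewrite coefC; case: eqP => _ //; rewrite -(mpolyC0 n0 F); exact: computable_const.
- by move=> j _; right; exists j; rewrite // -ltnS N1.
by move=> D' p; right.
Qed.

Hypotheses (regA : T_regularized A) (rootA : approx_root k A Phi).
Hypotheses (truncPhi : truncated k Phi) (ndA : non_degenerate A Phi).

Lemma eval_shifted_coef eta j (w : 'I_n0 -> F) :
  (shifted_coef (root_base Phi) eta j).@[w] =
  ((shifted_at A Phi (fun i => (X i).@[w])).[eta%:R%:P * 'X])`_j.
Proof.
rewrite horner_shifted_at /shifted_coef -[_.@[w]]/(meval w _) -coef_map /=.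
congr (nth _ (polyseq _) _); rewrite rmorph_mmap.
apply: eq_mmap => [c|i] /=; first by rewrite map_polyC /= mevalC.
rewrite /shifted_input /rcons_pt /cons_pt; case: unlift => [i'|]; last first.
  by rewrite rmorphD rmorphM /= map_polyX !map_polyC /= mevalC rmorph_nat.
by case: unlift => [i''|]; rewrite ?map_polyX ?map_polyC.
Qed.

(** The weights do not depend on the point, so the closed formula is a polynomial identity in w; at
    each w it is [approximate_root_value] for Phi with x fixed to X(w). The depth 7 is 3 for
    [shifted_affine], 1 for the power, 2 for the combination and 1 for the constant. *)
Lemma computable_root t :
  computable_by (mmap (@mpolyC n0 F) (cons_pt t%:MP X) Phi) (D + 5 * Delta + 7)
    (root_cost k s s0).
Proof.
pose alpha := root_slope A Phi; pose phi0 := root_base Phi.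
have [W WP] := @approximate_root_value F F0 k (3 * k).-1 alpha t.
have N1 : (3 * k).-1.+1 = (3 * k)%N by rewrite prednK // muln_gt0.
rewrite N1 in WP.
pose Ix : finType := ('I_(2 * k) * 'I_((3 * k) * (2 * k)).+1 * 'I_(3 * k).+1)%type.
have -> : mmap (@mpolyC n0 F) (cons_pt t%:MP X) Phi = phi0%:MP +
  \sum_(i : Ix) (W i.1.1 i.1.2 i.2)%:MP * shifted_affine phi0 alpha i.2 i.1.2 ^+ i.1.1.+1.
  apply: (mpoly_eq_eval F0) => w; pose x i := (X i).@[w].
  have -> : (mmap (@mpolyC n0 F) (cons_pt t%:MP X) Phi).@[w] = (root_at Phi x).[t].
    rewrite horner_root_at -[LHS]/(meval w _) rmorph_mmap.
    apply: eq_mmap => [c|i] /=; first by rewrite mevalC.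
    by rewrite /cons_pt; case: unlift => [j|]; rewrite ?mevalC.
  pose rho eta := take_poly (3 * k) (shifted_at A Phi x).[eta%:R%:P * 'X].
  have sc : (size (root_at Phi x - phi0%:P)%R <= k)%N.
    rewrite (leq_trans (size_polyD _ _)) // geq_max size_polyN size_root_at //=.
    exact: leq_trans (size_polyC_leq1 _) k_gt0.
  have srho eta : (size (rho eta) <= 3 * k)%N by apply: size_take_poly.
  have rhoE eta : eqT (3 * k) (rho eta) (shifted_at A Phi x).[eta%:R%:P * 'X].
    by move=> j ltj; rewrite coef_take_poly ltj.
  have c0 : (root_at Phi x - phi0%:P)`_0 = 0.
    by rewrite coefB coefC (root_at_coef0 k_gt0 regA rootA ndA) subrr.
  have := WP (shifted_at A Phi x) (root_at Phi x - phi0%:P) rho ndA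
    (shifted_at00 k_gt0 regA rootA x) (shifted_at10 k_gt0 regA rootA x) c0
    (root_at_approx rootA x) sc srho rhoE.
  rewrite hornerD hornerN hornerC => /eqP; rewrite subr_eq addrC => /eqP ->.
  rewrite mevalD mevalC; congr (_ + _).
  rewrite pair_bigA pair_bigA raddf_sum; apply: eq_bigr => -[[m u] eta] _ /=.
  rewrite mevalM mevalC rmorphXn /=; congr (_ * _ ^+ _).
  rewrite mevalD mevalC; congr (_ + _).
  rewrite (horner_coef_wide _ (size_take_poly _ _)) mulr_sumr -sumrN raddf_sum.
  apply: eq_bigr => j _ /=; rewrite mevalM mevalC eval_shifted_coef coef_take_poly ltn_ord.
  by ring.
have -> : (D + 5 * Delta + 7 = (D + 5 * Delta + 3).+4)%N by lia.
have cI : #|{: Ix}| = (2 * k * (3 * k * (2 * k)).+1 * (3 * k).+1)%N.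
  by rewrite !card_prod !card_ord.
rewrite /root_cost -cI; apply: computable_addC; apply: computable_lin => -[[m u] eta] /=.
apply: (computableW (computable_exp m.+1 (computable_shifted_affine phi0 alpha eta u))) => //.
by rewrite leq_add2l; apply: ltn_ord.
Qed.

End RootCircuit.

(** * Circuits for roots of implicit equations *)

Lemma derivn_comp_translate (S : comNzRingType) (p : {poly S}) z e :
  (p \Po ('X + z%:P))^`(e) = p^`(e) \Po ('X + z%:P).
Proof.
elim: e => [|e IH]; first by rewrite !derivn0.
by rewrite !derivnS IH deriv_comp derivD derivX derivC addr0 mulr1.
Qed.

(** The derivative is e! times the coefficient of y^e in p(y + z), which is interpolated; circuits
    for derivatives thus only need values of p. *)
Lemma derivn_finite_difference (F : fieldType) D e : [pchar F] =i pred0 ->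
  exists c : nat -> F, forall (S : comNzRingType) (f : {rmorphism F -> S}) (p : {poly S}) z,
  (size p <= D.+1)%N -> p^`(e).[z] = \sum_(b < D.+1) f (c b) * p.[z + b%:R].
Proof.
move=> F0; have [w wP] := coef_interpolation F0 D.
exists (fun b => e`!%:R * w e b) => S f p z sp.
pose q := p \Po ('X + z%:P).
have sq : (size q <= D.+1)%N.
  rewrite (leq_trans (size_comp_poly_leq _ _)) // size_XaddC /= muln1.
  by case: (size p) sp.
have -> : p^`(e).[z] = q^`(e)`_0.
  by rewrite derivn_comp_translate -horner_coef0 horner_comp hornerD hornerX hornerC add0r.
rewrite coef_derivn addn0 ffactnn (wP e S f q sq) -[LHS]mulr_natl mulr_sumr.
apply: eq_bigr => b _; rewrite rmorphM rmorph_nat mulrA; congr (_ * _).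
by rewrite horner_comp hornerD hornerX hornerC addrC.
Qed.

Lemma size_mmap_poly (F : fieldType) (S : comNzRingType) (f : F -> S) n
    (p : {mpoly F[n]}) (h : 'I_n -> {poly S}) e :
  (forall i, size (h i) <= e.+1)%N ->
  (size (mmap (polyC \o f) h p) <= (mdegree p * e).+1)%N.
Proof.
move=> sh; rewrite /mmap (leq_trans (size_sum _ _ _)) //.
apply/bigmax_leqP_seq => m mp _; rewrite /= mul_polyC (leq_trans (size_scale_leq _ _)) //.
have : (size (mmap1 h m) <= (mdeg m * e).+1)%N.
  rewrite /mmap1 mdegE big_distrl /=.
  apply: (big_ind2 (fun (q : {poly S}) c => (size q <= c.+1)%N)).
  - by rewrite size_poly1.
  - move=> q c q' c' lq lq'; rewrite (leq_trans (size_polyMleq _ _)) //.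
    rewrite -subn1 leq_subLR add1n -addSn -addnS; exact: leq_add.
  move=> i _; rewrite (leq_trans (size_poly_exp_leq _ _)) // ltnS mulnC leq_mul //.
  by have := sh i; case: (size (h i)).
move/leq_trans; apply; rewrite ltnS leq_mul //.
have := msize_mdeg_lt mp; rewrite /mdegree; by case: (msize p).
Qed.

(** The top derivative of R is a nonzero constant in characteristic zero, so some derivative does
    not vanish at g; the least such order is positive, and [e] is its predecessor. *)
Lemma exists_simple_derivative (P : idomainType) (R : {poly P}) g :
  [pchar P] =i pred0 -> R != 0 -> R.[g] = 0 ->
  exists e, R^`(e).[g] = 0 /\ R^`(e.+1).[g] != 0.
Proof.
move=> P0 R0 Rg; have exe : exists e, R^`(e).[g] != 0.
  exists (size R).-1; have sR : (0 < size R)%N by rewrite size_poly_gt0.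
  have : (size R^`((size R).-1) <= 1)%N.
    apply/leq_sizeP => j j1; rewrite coef_derivn nth_default ?mul0rn //.
    by rewrite -(prednK sR) /= -addn1 leq_add2l.
  move/size1_polyC => ->; rewrite hornerC coef_derivn addn0 ffactnn.
  rewrite -mulr_natr mulf_neq0 //; first by rewrite -[_`__]/(lead_coef R) lead_coef_eq0.
  by move/pcharf0P: P0 => ->; rewrite -lt0n fact_gt0.
case: (ex_minnP exe) => -[|e] ne min; first by rewrite derivn0 Rg eqxx in ne.
exists e; split=> //; apply/eqP; apply: contraT => /min; by rewrite ltnn.
Qed.

(* The factors beyond the degree of m are padded by None, which stands for 1. *)
Lemma mmap1_padded (S : comNzRingType) n (m : 'X_{1..n}) d : (mdeg m <= d)%N ->
  exists s : 'I_d -> option 'I_n, forall h : 'I_n -> S, mmap1 h m = \prod_(i < d) oapp h 1 (s i).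
Proof.
move=> md; pose l := flatten [seq nseq (m i) (Some i) | i <- enum 'I_n] ++ nseq (d - mdeg m) None.
have sl : size l = d.
  rewrite size_cat size_nseq size_flatten /shape -map_comp sumnE big_map.
  rewrite (eq_bigr (fun i => m i)) => [|i _]; last by rewrite /= size_nseq.
  by rewrite big_enum -mdegE subnKC.
exists (fun i => nth None l i) => h.
have -> : \prod_(i < d) oapp h 1 (nth None l i) = \prod_(o <- l) oapp h 1 o.
  by rewrite (big_nth None) sl big_mkord.
rewrite big_cat /= [X in _ * X]big_nseq iter_fix ?mulr1 //.
rewrite big_flatten big_map big_enum; apply: eq_bigr => i _.
by rewrite big_nseq -Monoid.iteropE.
Qed.

(** * Expansion of a polynomial in few linear forms *)

Section Sparse.

Variables (F : fieldType) (n sigma d : nat) (I : finType).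
Local Notation P := {mpoly F[n]}.

(** Each monomial, padded to d factors, is a product of d elements of the span of [y] and expands
    over the functions from ['I_d] to [I]. The number of products is thus independent of sigma. *)
Lemma mmap_lin_expand (g : {mpoly F[sigma]}) (y : I -> P) (L : 'I_sigma -> P) (one : I) :
  mdegree g = d -> y one = 1 ->
  (forall a, exists c : I -> F, L a = \sum_i (c i)%:MP * y i) ->
  exists c : {ffun 'I_d -> I} -> F,
  mmap (@mpolyC n F) L g = \sum_(phi : {ffun 'I_d -> I}) (c phi)%:MP * \prod_(i < d) y (phi i).
Proof.
move=> dg y1 Llin.
have mon m : m \in msupp g -> exists c : {ffun 'I_d -> I} -> F,
    mmap1 L m = \sum_(phi : {ffun 'I_d -> I}) (c phi)%:MP * \prod_(i < d) y (phi i).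
  move=> mg; have md : (mdeg m <= d)%N.
    by have := msize_mdeg_lt mg; rewrite -dg /mdegree; case: (msize g).
  have [s sE] := mmap1_padded P md.
  have Llin' (o : option 'I_sigma) : exists c : {ffun I -> F}, oapp L 1 o = \sum_i (c i)%:MP * y i.
    case: o => [a|] /=.
      have [c ->] := Llin a; exists [ffun i => c i].
      by apply: eq_bigr => i _; rewrite ffunE.
    exists [ffun i => (i == one)%:R]; rewrite (bigD1 one) //= ffunE eqxx y1 mulr1 mpolyC1.
    by rewrite big1 ?addr0 // => i ne; rewrite ffunE (negPf ne) mpolyC0 mul0r.
  have [c cE] : exists c : {ffun 'I_d -> {ffun I -> F}},
      forall i, oapp L 1 (s i) = \sum_j (c i j)%:MP * y j.
    have : forall r : seq 'I_d, exists c : {ffun 'I_d -> {ffun I -> F}},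
      forall i, i \in r -> oapp L 1 (s i) = \sum_j (c i j)%:MP * y j.
      elim=> [|i r [c IH]]; first by exists [ffun=> [ffun=> 0]].
      have [ci ciE] := Llin' (s i); exists [ffun i' => if i' == i then ci else c i'] => i'.
      by rewrite inE ffunE; case: eqP => [->|_] //= /IH.
    by move=> /(_ (enum 'I_d)) [c cE]; exists c => i; apply: cE; rewrite mem_enum.
  exists (fun phi => \prod_i c i (phi i)).
  rewrite sE (eq_bigr _ (fun i _ => cE i)) bigA_distr_bigA /=.
  by apply: eq_bigr => phi _; rewrite big_split rmorph_prod.
rewrite /mmap; elim: (msupp g) mon => [|m r IH] mon.
  by exists (fun=> 0); rewrite big_nil big1 // => phi _; rewrite mpolyC0 mul0r.
have [|c cE] := IH; first by move=> m' m'r; apply: mon; rewrite inE m'r orbT.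
have [c' c'E] := mon m (mem_head _ _).
exists (fun phi => g@_m * c' phi + c phi); rewrite big_cons cE c'E mulr_sumr -big_split /=.
by apply: eq_bigr => phi _; rewrite mpolyCD mpolyCM; ring.
Qed.

Lemma computable_lin_expand (g : {mpoly F[sigma]}) (y : I -> P) (L : 'I_sigma -> P) (one : I) :
  mdegree g = d -> y one = 1 ->
  (forall a, exists c : I -> F, L a = \sum_i (c i)%:MP * y i) ->
  (forall i, computable_by (y i) 0 0) ->
  computable_by (mmap (@mpolyC n F) L g) 3 (#|I| ^ d * (d + 3)).
Proof.
move=> dg y1 Llin cy; have [c ->] := mmap_lin_expand dg y1 Llin.
have := @computable_lin F n {ffun 'I_d -> I} c (fun phi => \prod_(i < d) y (phi i)) 1 d.
rewrite card_ffun card_ord; apply => phi.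
by apply: (computableW (computable_prod (fun i => cy (phi i)))); rewrite // card_ord muln1.
Qed.

End Sparse.

Lemma mpoly_neq0_eval (F : fieldType) n (p : {mpoly F[n]}) : [pchar F] =i pred0 ->
  p != 0 -> exists v, p.@[v] != 0.
Proof.
move=> F0 p0; apply: NNPP => ne; case/eqP: p0; apply: (mpoly_eq0_eval F0) => v.
by apply/eqP; apply: contraT => pv; case: ne; exists v.
Qed.

(** The analogue of [root_cost] with k = d + 1 and E = D (d + 1); each summand combines D + 1 values
    of the equation, which produce the z-derivative. *)
Definition implicit_cost (D d sR : nat) : nat :=
  (2 * d.+1 * ((D * d.+1).+1 * (2 * d.+1)).+1 * (3 * d.+1).+1 *
   (D.+1 * (sR + 3) + 2 + 2 * d.+1 + 3) + 2)%N.

Section ImplicitRoot.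

Variables (F : fieldType) (n sigma d sK DR sR : nat) (t : F) (i0 : 'I_n).
Local Notation P := {mpoly F[sigma]}.
Variables (Cp : {mpoly F[n.+1]}) (kk : 'I_n -> P) (g : P).
Hypothesis F0 : [pchar F] =i pred0.
Hypothesis dg : mdegree g = d.

Let D := mdegree Cp.

(** The polynomial R(w, z), seen as a polynomial in z. *)
Definition implicit_poly : {poly P} :=
  mmap (polyC \o @mpolyC sigma F)
    (cons_pt t%:MP%:P (fun j => if j == i0 then 'X else (kk j)%:P)) Cp.

Lemma horner_implicit_poly (S : comNzRingType) (f : {rmorphism F -> S}) (h : 'I_sigma -> S) z :
  (map_poly (mmap f h) implicit_poly).[z] =
  mmap f (cons_pt (f t) (fun j => if j == i0 then z else mmap f h (kk j))) Cp.
Proof.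
rewrite -[LHS]/((horner_eval z \o map_poly (mmap f h)) _) [LHS]rmorph_mmap.
apply: eq_mmap => [c|i] /=; first by rewrite map_polyC /= mmapC /horner_eval hornerC.
rewrite /cons_pt; case: unlift => [j|]; last by rewrite map_polyC /= mmapC /horner_eval hornerC.
by case: eqP => _; rewrite ?map_polyX ?map_polyC /horner_eval ?hornerX ?hornerC.
Qed.

Hypothesis implicit0 : implicit_poly != 0.
Hypothesis implicit_root : implicit_poly.[g] = 0.
Hypothesis size_kk : forall j (h : 'I_sigma -> {poly F}),
  (forall a, size (h a) <= 2)%N -> (size (mmap (@polyC F) h (kk j)) <= d.+2)%N.
Hypothesis comp_kk : forall j (c : 'I_sigma -> F) (u : F),
  computable_by (mmap (@mpolyC sigma F) (fun a => (c a)%:MP + u%:MP * 'X_a) (kk j)) 3 sK.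
Hypothesis comp_Cp : forall X : 'I_n -> P, (forall j, computable_by (X j) 3 sK) ->
  computable_by (mmap (@mpolyC sigma F) (cons_pt t%:MP X) Cp) DR sR.

Lemma size_implicit_poly : (size implicit_poly <= D.+1)%N.
Proof.
have := @size_mmap_poly F P (@mpolyC sigma F) _ Cp
  (cons_pt t%:MP%:P (fun j => if j == i0 then 'X else (kk j)%:P)) 1.
rewrite muln1; apply => i; rewrite /cons_pt.
have sC (p : P) : (size p%:P <= 2)%N by apply: leq_trans (size_polyC_leq1 _) _.
by case: unlift => [j|] //; case: eqP => _ //; rewrite size_polyX.
Qed.

Definition implicit_value (c : 'I_sigma -> F) (u z : F) : P :=
  mmap (@mpolyC sigma F) (cons_pt t%:MP (fun j => if j == i0 then z%:MP else
    mmap (@mpolyC sigma F) (fun a => (c a)%:MP + u%:MP * 'X_a) (kk j))) Cp.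

Lemma computable_implicit_value c u z : computable_by (implicit_value c u z) DR sR.
Proof. by apply: comp_Cp => j; case: eqP => _ //; apply: computable_const. Qed.

(** On the line w0 + u (w - w0), with u in the role of T, g is an exact root of Q and has degree at
    most d in u. It is simple at u = 0 because Q'(g) does not vanish at w0. So d + 1 coefficients
    determine g on the line, and u = 1 gives g(w). *)
Lemma computable_implicit_root : computable_by g (DR + 7) (implicit_cost D d sR).
Proof.
have P0 : [pchar P] =i pred0.
  apply/pcharf0P => m; rewrite -(rmorph_nat (@mpolyC sigma F)) mpolyC_eq0.
  by move/pcharf0P: F0 => ->.
have [e [Qg Q'g]] := exists_simple_derivative P0 implicit0 implicit_root.
pose Q := implicit_poly^`(e); rewrite -/Q in Qg; rewrite derivnS -/Q in Q'g.
have [w0 w0P] := mpoly_neq0_eval F0 Q'g.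
pose alpha := (Q^`().[g]).@[w0]; have [g0 g0E] : exists x, x = g.@[w0] by exists g.@[w0].
have [c cP] := derivn_finite_difference D e F0.
have [W WP] := @approximate_root_value F F0 d.+1 (D * d.+1) alpha 1.
(* The point w0 + u (w - w0) is rewritten as (1 - u) w0 + u w, which is affine in the variables w
   with scalar coefficients. *)
pose base u a := (1 - u) * w0 a.
pose affine eta u : P := (eta%:R * u%:R)%:MP + \sum_(b < D.+1) (- alpha^-1 * c b)%:MP *
   implicit_value (base u%:R) u%:R (eta%:R * u%:R + g0 + b%:R).
pose Ix : finType := ('I_(2 * d.+1) * 'I_((D * d.+1).+1 * (2 * d.+1)).+1 * 'I_(3 * d.+1).+1)%type.
have -> : g = g0%:MP +
  \sum_(i : Ix) (W i.1.1 i.1.2 i.2)%:MP * affine i.2 i.1.2 ^+ i.1.1.+1.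
  apply: (mpoly_eq_eval F0) => w.
  pose h a : {poly F} := (w0 a)%:P + (w a - w0 a)%:P * 'X.
  have sh a : (size (h a) <= 2)%N.
    rewrite (leq_trans (size_polyD _ _)) // geq_max (leq_trans (size_polyC_leq1 _)) //=.
    by rewrite mul_polyC (leq_trans (size_scale_leq _ _)) // size_polyX.
  pose lam := mmap (@polyC F) h.
  have lam_eval p u : (lam p).[u] = p.@[fun a => w0 a + u * (w a - w0 a)].
    rewrite -[LHS]/(horner_eval u _) rmorph_mmap; apply: eq_mmap => [c'|a] /=.
      by rewrite /horner_eval hornerC.
    by rewrite /horner_eval /h hornerD hornerM !hornerC hornerX mulrC.
  pose r := map_poly lam Q \Po ('X + g0%:P%:P).
  have rq q : r.[q] = (map_poly lam Q).[q + g0%:P].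
    by rewrite /r horner_comp hornerD hornerX hornerC.
  have lam0 p : (lam p)`_0 = p.@[w0].
    rewrite -horner_coef0 lam_eval; apply: meval_eq => a; by rewrite mul0r addr0.
  have rE q : r.[q] = \sum_(b < D.+1) (c b)%:P *
      mmap (@polyC F) (cons_pt t%:P (fun j => if j == i0 then q + g0%:P + b%:R else lam (kk j))) Cp.
    rewrite rq /Q -derivn_map (cP _ (@polyC F)); last first.
      exact: leq_trans (size_poly _ _) size_implicit_poly.
    by apply: eq_bigr => b _; rewrite -horner_implicit_poly.
  (* The degree D may enter the final bound, so the restriction to the line is used without
     truncation. The degree bound d + 1 on the coordinates also covers the linear one, eta T, when d
     = 0. *)
  have sr eta : (size r.[eta%:R%:P * 'X] <= (D * d.+1).+1)%N.
    rewrite rE (leq_trans (size_sum _ _ _)) //; apply/bigmax_leqP => b _.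
    rewrite mul_polyC (leq_trans (size_scale_leq _ _)) //.
    apply: (@size_mmap_poly F F idfun n.+1 Cp _ d.+1) => i.
    rewrite /cons_pt; case: unlift => [j|]; last exact: leq_trans (size_polyC_leq1 _) _.
    case: eqP => _; last exact: size_kk.
    rewrite -addrA -(rmorph_nat (@polyC F)) -rmorphD.
    rewrite (leq_trans (size_polyD _ _)) // geq_max (leq_trans (size_polyC_leq1 _)) // andbT.
    by rewrite mul_polyC (leq_trans (size_scale_leq _ _)) // size_polyX.
  have ri i : r`_i`_0 = (map_poly (meval w0) Q \Po ('X + g0%:P))`_i.
    rewrite -horner_coef0 -[LHS]/(horner_eval 0 _) -coef_map /=.
    congr (nth _ (polyseq _) _); rewrite map_comp_poly.
    have -> : map_poly (horner_eval 0) (map_poly lam Q) = map_poly (meval w0) Q.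
      by apply/polyP => b; rewrite !coef_map /= /horner_eval horner_coef0 lam0.
    by rewrite rmorphD /= map_polyX map_polyC /= /horner_eval hornerC.
  have r00 : r`_0`_0 = 0.
    rewrite ri -horner_coef0 horner_comp hornerD hornerX hornerC add0r.
    by rewrite g0E horner_map /= Qg meval0.
  have r10 : r`_1`_0 = alpha.
    rewrite ri; have := coef_deriv (map_poly (meval w0) Q \Po ('X + g0%:P)) 0.
    rewrite mulr1n => <-.
    rewrite -horner_coef0 deriv_comp derivD derivX derivC addr0 mulr1.
    by rewrite horner_comp hornerD hornerX hornerC add0r deriv_map g0E horner_map.
  have c0 : (lam g - g0%:P)`_0 = 0 by rewrite coefB coefC lam0 g0E subrr.
  have rc : eqT d.+1 r.[lam g - g0%:P] 0.
    by move=> j _; rewrite rq subrK horner_map /= Qg rmorph0.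
  have sc : (size (lam g - g0%:P)%R <= d.+1)%N.
    rewrite (leq_trans (size_polyD _ _)) // geq_max size_polyN.
    rewrite (leq_trans (size_polyC_leq1 _)) // andbT.
    by have := @size_mmap_poly F F idfun _ g h 1 sh; rewrite muln1 dg.
  have := WP r (lam g - g0%:P) (fun eta => r.[eta%:R%:P * 'X]) w0P r00 r10 c0 rc sc sr
    (fun eta => fun j _ => erefl).
  rewrite hornerD hornerN hornerC lam_eval => /eqP; rewrite subr_eq addrC => /eqP.
  have -> : g.@[fun a => w0 a + 1 * (w a - w0 a)] = g.@[w].
    by apply: meval_eq => a; rewrite mul1r addrC subrK.
  move=> ->; rewrite mevalD mevalC; congr (_ + _).
  rewrite pair_bigA pair_bigA raddf_sum; apply: eq_bigr => -[[m u] eta] _ /=.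
  rewrite mevalM mevalC rmorphXn /=; congr (_ * _ ^+ _).
  rewrite mevalD mevalC; congr (_ + _).
  rewrite rE horner_sum mulr_sumr -sumrN raddf_sum; apply: eq_bigr => b _ /=.
  rewrite mevalM mevalC hornerM hornerC mulrA mulNr mulNr; congr (- (_ * _)).
  rewrite -[LHS]/(horner_eval u%:R _) [LHS]rmorph_mmap -[RHS]/(meval w _) rmorph_mmap.
  apply: eq_mmap => [c'|i] /=; first by rewrite /horner_eval hornerC mevalC.
  rewrite /cons_pt; case: unlift => [j|]; last by rewrite /horner_eval hornerC mevalC.
  case: eqP => _.
    by rewrite /horner_eval !hornerD hornerM !hornerC hornerX mevalC -polyC_natr hornerC.
  rewrite /horner_eval lam_eval -[RHS]/(meval w _) rmorph_mmap.
  apply: eq_mmap => [c'|a] /=; first by rewrite mevalC.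
  by rewrite mevalD mevalM !mevalC mevalXU /base; ring.
have -> : (DR + 7 = (DR + 3).+4)%N by lia.
have cI : #|{: Ix}| = (2 * d.+1 * ((D * d.+1).+1 * (2 * d.+1)).+1 * (3 * d.+1).+1)%N.
  by rewrite !card_prod !card_ord.
rewrite /implicit_cost -cI; apply: computable_addC; apply: computable_lin => -[[m u] eta] /=.
have ca : computable_by (affine eta u) (DR + 3) (D.+1 * (sR + 3) + 2).
  rewrite addn3; apply: computable_addC.
  apply: (computableW (computable_lin _ (fun b => computable_implicit_value _ _ _))) => //.
  by rewrite card_ord.
apply: (computableW (computable_exp m.+1 ca)) => //.
by rewrite leq_add2l; apply: ltn_ord.
Qed.

End ImplicitRoot.

(** * The hybrid argument *)

(** If no index worked, the coordinates could be freed from K one at a time, starting with the last,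
    without losing the vanishing; in the end Cp would vanish everywhere. *)
Lemma hybrid_argument (F : fieldType) n mu (Cp : {mpoly F[n.+1]}) (K : 'I_n -> {mpoly F[mu]}) :
  [pchar F] =i pred0 -> Cp != 0 ->
  (forall t w, Cp.@[cons_pt t (fun j => (K j).@[w])] = 0) ->
  exists (i0 : 'I_n) t x w0,
    (forall w, Cp.@[cons_pt t (fun j => if (j <= i0)%N then (K j).@[w] else x j)] = 0) /\
    Cp.@[cons_pt t (fun j => if (j < i0)%N then (K j).@[w0] else x j)] != 0.
Proof.
move=> F0 Cp0 CK; apply: NNPP => ne.
have all0 m : (m <= n)%N -> forall t w x,
    Cp.@[cons_pt t (fun j => if (j < n - m)%N then (K j).@[w] else x j)] = 0.
  elim: m => [|m IH] lem t w x.
    rewrite -[RHS](CK t w); apply: meval_eq; apply: eq_cons_pt => // j.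
    by rewrite subn0 ltn_ord.
  have ltn : (n - m.+1 < n)%N by lia.
  apply/eqP; apply: contraT => neq0; case: ne.
  exists (Ordinal ltn), t, x, w; split=> //= w'.
  rewrite -[RHS](IH (ltnW lem) t w' x); apply: meval_eq; apply: eq_cons_pt => // j.
  by rewrite (_ : (j <= n - m.+1)%N = (j < n - m)%N) //; lia.
have [v vP] := mpoly_neq0_eval F0 Cp0; case/eqP: vP.
rewrite -[RHS](all0 n (leqnn n) (v ord0) (fun=> 0) (fun j => v (lift ord0 j))).
apply: meval_eq => i; rewrite subnn /cons_pt.
by case: unliftP => [j ->|->].
Qed.

(** * Fixing the variables outside one set of the design *)

Section Embedding.

Variables (mu sigma : nat) (S0 : {set 'I_mu}).
Hypothesis cardS : #|S0| = sigma.

Definition position (v : 'I_mu) : option 'I_sigma := insub (index v (enum S0)).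

Definition embed T (c : 'I_mu -> T) (w : 'I_sigma -> T) : 'I_mu -> T :=
  fun v => if position v is Some a then w a else c v.

Lemma size_enumS : size (enum S0) = sigma. Proof. by rewrite -cardE. Qed.

Lemma position_nth v0 (a : 'I_sigma) : position (nth v0 (enum S0) a) = Some a.
Proof.
rewrite /position index_uniq ?enum_uniq ?size_enumS // insubT //= => lt.
by congr Some; apply: val_inj.
Qed.

Lemma position_notin v : v \notin S0 -> position v = None.
Proof. by move=> vS; rewrite /position insubN // -size_enumS index_mem mem_enum. Qed.

Lemma position_in v : v \in S0 -> exists2 a, position v = Some a & nth v (enum S0) a = v.
Proof.
move=> vS; have lt : (index v (enum S0) < sigma)%N by rewrite -size_enumS index_mem mem_enum.
by exists (Ordinal lt); rewrite ?/position ?insubT //= nth_index // mem_enum.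
Qed.

Lemma embed_nth (R : nzRingType) (c : 'I_mu -> R) w (a : 'I_sigma) :
  (map (embed c w) (enum S0))`_a = w a.
Proof.
have lt : (a < size (enum S0))%N by rewrite size_enumS.
case: (enum S0) lt (position_nth ^~ a) => // v0 s lt pos.
by rewrite (nth_map v0) // /embed pos.
Qed.

Lemma embed_id (R : nzRingType) (c : 'I_mu -> R) :
  embed c (fun a => (map c (enum S0))`_a) =1 c.
Proof.
move=> v; rewrite /embed; have [vS|vS] := boolP (v \in S0); last by rewrite position_notin.
have [a -> av] := position_in vS.
by rewrite (nth_map v) ?size_enumS ?av.
Qed.

End Embedding.

Section KIEvaluation.

Variables (F : fieldType) (n sigma mu : nat) (g : {mpoly F[sigma]}) (S : 'I_n -> {set 'I_mu}).
Hypothesis cardS : forall i, #|S i| = sigma.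

Lemma mmap_KI (R : comNzRingType) (f : {rmorphism F -> R}) (y : 'I_mu -> R) j :
  mmap f y (KI g S j) = mmap f (fun a : 'I_sigma => (map y (enum (S j)))`_a) g.
Proof.
rewrite mmap_comp; apply: eq_mmap => // a; rewrite tnth_mktuple.
have lt : (a < size (enum (S j)))%N by rewrite (size_enumS (cardS j)).
case: (enum (S j)) lt => // v0 s lt.
by rewrite !(nth_map v0) // mmapX mmap1U.
Qed.

Lemma mmap_KI_embed (R : comNzRingType) (f : {rmorphism F -> R}) (c : 'I_mu -> R) w i :
  mmap f (embed (S i) c w) (KI g S i) = mmap f w g.
Proof. by rewrite mmap_KI; apply: eq_mmap => // a; rewrite embed_nth. Qed.

Lemma mmap_KI_eq (R : comNzRingType) (f : {rmorphism F -> R}) (y y' : 'I_mu -> R) j :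
  {in S j, y =1 y'} -> mmap f y (KI g S j) = mmap f y' (KI g S j).
Proof.
move=> e; rewrite !mmap_KI; apply: eq_mmap => // a; congr (_`_a).
by apply/eq_in_map => v; rewrite mem_enum => /e.
Qed.

Lemma mmap_subst_KI (R : comNzRingType) (f : {rmorphism F -> R})
    (Cp : {mpoly F[n.+1]}) t (w : 'I_mu -> R) :
  mmap f (cons_pt t w) (subst_KI g S Cp) = mmap f (cons_pt t (fun j => mmap f w (KI g S j))) Cp.
Proof.
rewrite mmap_comp; apply: eq_mmap => // i; rewrite tnth_mktuple [in RHS]/cons_pt.
case: unlift => [j|]; last by rewrite mmapX mmap1U cons_pt0.
rewrite mmap_comp; apply: eq_mmap => // v.
by rewrite tnth_mktuple mmapX mmap1U cons_pt_lift.
Qed.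

End KIEvaluation.

Lemma mmap_subst_y (F : fieldType) n l (R : comNzRingType) (f : {rmorphism F -> R})
    (Cy : {mpoly F[n.+1 + l]}) (Phi : 'I_l -> {mpoly F[n.+1]}) (h : 'I_n.+1 -> R) :
  mmap f h (subst_y Cy Phi) =
  mmap f (fun i => match split i with inl j => h j | inr j => mmap f h (Phi j) end) Cy.
Proof.
rewrite mmap_comp; apply: eq_mmap => // i; rewrite tnth_mktuple.
by case: split => j //; rewrite mmapX mmap1U.
Qed.

(** * Size estimates by powers of a common base *)

Section PowerBounds.

Variable Z : nat.
Hypothesis Z2 : (1 < Z)%N.

Lemma pow_bound_mul a b i j :
  (a <= Z ^ i)%N -> (b <= Z ^ j)%N -> (a * b <= Z ^ (i + j))%N.
Proof. by move=> la lb; rewrite expnD leq_mul. Qed.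

(** The factor 2 of a sum of two terms is absorbed by one more power of Z. *)
Lemma pow_bound_add a b i j :
  (a <= Z ^ i)%N -> (b <= Z ^ j)%N -> (a + b <= Z ^ (i + j).+1)%N.
Proof.
move=> la lb; have Z0 : (0 < Z)%N by apply: ltnW.
have le1 : (a <= Z ^ (i + j))%N by apply: leq_trans la _; rewrite leq_pexp2l ?leq_addr.
have le2 : (b <= Z ^ (i + j))%N by apply: leq_trans lb _; rewrite leq_pexp2l ?leq_addl.
rewrite expnS; apply: leq_trans (leq_add le1 le2) _.
by rewrite addnn -mul2n leq_mul2r Z2 orbT.
Qed.

Lemma pow_bound_S a i : (a <= Z ^ i)%N -> (a.+1 <= Z ^ i.+1)%N.
Proof.
move=> la; have := @pow_bound_add a 1 i 0 la; rewrite addn1 addn0; exact.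
Qed.

Lemma pow_bound_sqr a i : (a <= Z ^ i)%N -> (a ^ 2 <= Z ^ (i + i))%N.
Proof. by move=> la; rewrite -mulnn; apply: pow_bound_mul. Qed.

End PowerBounds.

(** The cost of C with its inputs replaced; [sK + root_cost k s sK] bounds the cost of a coordinate
    as well as that of a root. *)
Definition substitution_cost (k s sK : nat) : nat :=
  (s.+1 * (sK + root_cost k s sK) + 7 * s ^ 2)%N.

Lemma implicit_cost_bound : exists e, forall Z k s D d r : nat,
  (1 < Z)%N -> (k <= Z)%N -> (s <= Z)%N -> (D <= Z)%N -> (d <= Z)%N -> (r <= Z)%N ->
  (implicit_cost D d (substitution_cost k s (r * (d + 3))) <= Z ^ e)%N.
Proof.
(* The exponent is left open and is built up by following the structure of the cost expression, so
   it is an absolute number. *)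
eexists => Z k s D d r Z2 lk ls lD ld lr.
have b1 a : (a <= Z)%N -> (a <= Z ^ 1)%N by [].
rewrite /implicit_cost /substitution_cost /root_cost.
have b0 : (0 <= Z ^ 0)%N by [].
repeat match goal with
  | |- is_true (leq ?a _) => lazymatch a with
    | addn _ _ => apply: (pow_bound_add Z2)
    | muln _ _ => apply: pow_bound_mul
    | expn _ _ => apply: pow_bound_sqr
    | S _ => apply: (pow_bound_S Z2)
    | O => exact: b0
    | _ => apply: b1; assumption
    end
  end.
Qed.

(** * The implicit equation for g at the hybrid index *)

Section HybridRoot.

Variables (F : fieldType) (n sigma mu rho d : nat).
Variables (S : 'I_n -> {set 'I_mu}) (g : {mpoly F[sigma]}).
Hypothesis F0 : [pchar F] =i pred0.
Hypothesis design : is_design sigma rho S.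
Hypothesis dg : mdegree g = d.

Variables (Cp : {mpoly F[n.+1]}) (i0 : 'I_n) (t : F) (x : 'I_n -> F) (w0 : 'I_mu -> F).
Hypothesis hybrid_vanishes : forall w,
  Cp.@[cons_pt t (fun j => if (j <= i0)%N then (KI g S j).@[w] else x j)] = 0.
Hypothesis hybrid_neq0 :
  Cp.@[cons_pt t (fun j => if (j < i0)%N then (KI g S j).@[w0] else x j)] != 0.

Let cardS i : #|S i| = sigma. Proof. by case: design. Qed.

Lemma hybrid_vanishes_embed w :
  Cp.@[cons_pt t (fun j => if j == i0 then g.@[w] else
    if (j < i0)%N then (KI g S j).@[embed (S i0) w0 w] else x j)] = 0.
Proof.
rewrite -[RHS](hybrid_vanishes (embed (S i0) w0 w)); apply: meval_eq; apply: eq_cons_pt => // j.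
rewrite [in RHS]leq_eqVlt -val_eqE /=; case: eqP => //= e.
have -> : j = i0 by apply: val_inj.
by rewrite /meval (mmap_KI_embed _ cardS).
Qed.

(** The earlier sets are disjoint from S_(i0), so the equation [R0] is univariate; g restricted to
    the line through 0 and w is a root of it, whence g(w) = g(0). *)
Lemma constant_of_disjoint : (rho <= 1)%N -> exists c, g = c%:MP.
Proof.
move=> rho1.
have KIw (w : 'I_sigma -> F) (j : 'I_n) : (j < i0)%N ->
    (KI g S j).@[embed (S i0) w0 w] = (KI g S j).@[w0].
  move=> lt; apply: (mmap_KI_eq _ cardS) => v vj.
  rewrite /embed (@position_notin mu sigma (S i0) (cardS i0)) //.
  have ne : j != i0 by apply: contraTneq lt => ->; rewrite ltnn.
  have := design.2 _ _ ne; move/leq_trans/(_ rho1); rewrite ltnS leqn0 cards_eq0 => /eqP e.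
  by apply/negP => vi; move/setP: e => /(_ v); rewrite !inE vj vi.
pose R0 := mmap (@polyC F) (cons_pt t%:P (fun j => if j == i0 then 'X else
  (if (j < i0)%N then (KI g S j).@[w0] else x j)%:P)) Cp.
have R0E z : R0.[z] = Cp.@[cons_pt t (fun j => if j == i0 then z else
    if (j < i0)%N then (KI g S j).@[w0] else x j)].
  rewrite -[LHS]/(horner_eval z _) rmorph_mmap; apply: eq_mmap => [c|i] /=.
    by rewrite /horner_eval hornerC.
  rewrite /cons_pt /horner_eval; case: unlift => [j|]; last by rewrite hornerC.
  by case: eqP => _; rewrite ?hornerX ?hornerC.
(* At z = x_(i0) this polynomial takes the nonzero value of [hybrid_neq0]. *)
have R0n : R0 != 0.
  apply/eqP => R00; case/eqP: hybrid_neq0.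
  have := R0E (x i0); rewrite R00 horner0 => ->.
  apply: meval_eq; apply: eq_cons_pt => // j.
  by case: eqP => // ->; rewrite ltnn.
exists g.@[fun=> 0]; apply: (mpoly_eq_eval F0) => w; rewrite mevalC.
pose p := mmap (@polyC F) (fun a => w a *: 'X) g.
have pE s : p.[s] = g.@[fun a => s * w a].
  rewrite -[LHS]/(horner_eval s _) rmorph_mmap; apply: eq_mmap => [c|a] /=.
    by rewrite /horner_eval hornerC.
  by rewrite /horner_eval hornerZ hornerX mulrC.
have R0p : R0 \Po p = 0.
  apply: (poly_eq0_horner F0) => s; rewrite horner_comp R0E pE.
  rewrite -[RHS](hybrid_vanishes_embed (fun a => s * w a)).
  apply: meval_eq; apply: eq_cons_pt => // j; case: eqP => // _.
  by case: ifP => // lt; rewrite KIw.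
have /size1_polyC pc := algebraic_poly_const R0n R0p.
have -> : g.@[w] = p.[1] by rewrite pE; apply: meval_eq => a; rewrite mul1r.
have -> : g.@[fun=> 0] = p.[0] by rewrite pE; apply: meval_eq => a; rewrite mul0r.
by rewrite pc !hornerC.
Qed.

Definition hybrid_coord (j : 'I_n) : {mpoly F[sigma]} :=
  if (j < i0)%N then
    mmap (@mpolyC sigma F) (embed (S i0) (fun v => (w0 v)%:MP) (fun a => 'X_a)) (KI g S j)
  else (x j)%:MP.

Lemma mmap_hybrid_coord (R : comNzRingType) (f : {rmorphism F -> R}) h j :
  mmap f h (hybrid_coord j) =
  if (j < i0)%N then mmap f (embed (S i0) (f \o w0) h) (KI g S j) else f (x j).
Proof.
rewrite /hybrid_coord; case: ifP => _; last by rewrite mmapC.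
rewrite rmorph_mmap; apply: eq_mmap => [c|v] /=; first by rewrite mmapC.
by rewrite /embed; case: position => [a|]; rewrite ?mmapC // mmapX mmap1U.
Qed.

Lemma size_mmap_hybrid_coord j (h : 'I_sigma -> {poly F}) :
  (forall a, size (h a) <= 2)%N -> (size (mmap (@polyC F) h (hybrid_coord j)) <= d.+2)%N.
Proof.
move=> sh; rewrite mmap_hybrid_coord; case: ifP => _; last exact: leq_trans (size_polyC_leq1 _) _.
rewrite mmap_KI // -dg.
have := @size_mmap_poly F F idfun sigma g
  (fun a : 'I_sigma => (map (embed (S i0) (polyC \o w0) h) (enum (S j)))`_a) 1.
rewrite muln1 => le; apply: leq_trans (le _) _ => // a.
have lt : (a < size (enum (S j)))%N by rewrite (size_enumS (cardS j)).
rewrite (nth_map (enum_val (cast_ord (esym (cardS j)) a))) // /embed.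
by case: position => [b|]; [exact: sh | exact: leq_trans (size_polyC_leq1 _) _].
Qed.

(** Each variable in S_j is either a constant, outside S_(i0), or affine in one of the fewer than
    rho shared variables. Together with 1 these span at most rho dimensions, and
    [computable_lin_expand] gives rho^d products. *)
Lemma computable_mmap_hybrid_coord j (c : 'I_sigma -> F) (u : F) :
  computable_by (mmap (@mpolyC sigma F) (fun a => (c a)%:MP + u%:MP * 'X_a) (hybrid_coord j))
    3 (rho ^ d * (d + 3)).
Proof.
rewrite mmap_hybrid_coord; case: ifP => lt; last exact: computable_const.
rewrite mmap_KI //.
have ne : j != i0 by apply: contraTneq lt => ->; rewrite ltnn.
pose V := S j :&: S i0.
(* [None] carries the constant 1. The elements of [V] lie in S_(i0), so the default 0 is never
   reached. *)
pose y (i : option 'I_#|V|) : {mpoly F[sigma]} :=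
  if i is Some q then if position sigma (S i0) (enum_val q) is Some a then 'X_a else 0 else 1.
apply: (computableW (@computable_lin_expand F sigma sigma d (option 'I_#|V|) g y _ None
  dg erefl _ _)) => //.
- move=> a; have lta : (a < size (enum (S j)))%N by rewrite (size_enumS (cardS j)).
  pose v0 := enum_val (cast_ord (esym (cardS j)) a).
  have : nth v0 (enum (S j)) a \in S j by rewrite -mem_enum mem_nth.
  rewrite (nth_map v0) //; move: (nth v0 _ _) => v vj.
  rewrite /embed; case ev : position => [b|]; last first.
    exists (fun i => if i is None then w0 v else 0).
    rewrite (bigD1 None) //= mulr1 big1 ?addr0 // => -[q|] // _; by rewrite mpolyC0 mul0r.
  have vi : v \in S i0 by apply: contraT => /(@position_notin mu sigma _ (cardS i0)); rewrite ev.
  have vV : v \in V by rewrite inE vj vi.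
  pose q0 := enum_rank_in vV v.
  exists (fun i => if i is Some q then if q == q0 then u else 0 else c b).
  rewrite (bigD1 None) //= mulr1; congr (_ + _).
  rewrite (bigD1 (Some q0)) //= eqxx enum_rankK_in // ev big1 ?addr0 //.
  case=> [q|] //= neq; have /negPf-> : q != q0 by apply: contraNneq neq => ->.
  by rewrite mpolyC0 mul0r.
- case=> [q|] /=; last by rewrite -mpolyC1; apply: computable_const.
  case: position => [a|]; first exact: computable_var.
  by rewrite -(mpolyC0 sigma F); apply: computable_const.
rewrite leq_mul2r card_option card_ord; apply/orP; right.
by case: (d) => [|e]; rewrite ?expn0 // leq_exp2r //; apply: design.2.
Qed.

Lemma hybrid_implicit_root : (implicit_poly t i0 Cp hybrid_coord).[g] = 0.
Proof.
apply: (mpoly_eq0_eval F0) => w; rewrite -[LHS]/(meval w _) -horner_map /=.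
have := @horner_implicit_poly F n sigma t i0 Cp hybrid_coord _ idfun w g.@[w].
rewrite -/(meval w) => ->; rewrite -[RHS](hybrid_vanishes_embed w).
apply: eq_mmap => //; apply: eq_cons_pt => // j; case: eqP => // _.
by rewrite mmap_hybrid_coord.
Qed.

(** Its value at z = x_(i0) and at the restriction of w0 to S_(i0) is the one in [hybrid_neq0]. *)
Lemma hybrid_implicit_neq0 : implicit_poly t i0 Cp hybrid_coord != 0.
Proof.
apply/eqP => e; case/eqP: hybrid_neq0.
have := @horner_implicit_poly F n sigma t i0 Cp hybrid_coord _ idfun
  (fun a => (map w0 (enum (S i0)))`_a) (x i0).
rewrite e rmorph0 horner0 => ->.
apply: eq_mmap => //; apply: eq_cons_pt => // j; case: eqP => [->|_]; first by rewrite ltnn.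
rewrite mmap_hybrid_coord; case: ifP => // _.
by apply: eq_mmap => // v; rewrite embed_id.
Qed.

Lemma hybrid_root_computable DR sR :
  (forall X : 'I_n -> {mpoly F[sigma]},
    (forall j, computable_by (X j) 3 (rho ^ d * (d + 3))) ->
    computable_by (mmap (@mpolyC sigma F) (cons_pt t%:MP X) Cp) DR sR) ->
  computable_by g (DR + 7) (implicit_cost (mdegree Cp) d sR).
Proof.
exact: (computable_implicit_root F0 dg hybrid_implicit_neq0 hybrid_implicit_root
  size_mmap_hybrid_coord computable_mmap_hybrid_coord).
Qed.

End HybridRoot.

(** * Depth zero, and assembly of the bounds *)

Lemma depth0_circuit_poly (F : fieldType) n (C : circuit F n) : (circuit_depth C <= 0)%N ->
  (exists c, circuit_poly C = c%:MP) \/ (exists i, circuit_poly C = 'X_i).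
Proof.
rewrite /circuit_depth /circuit_poly; case: C => gs wf /=.
case/lastP: gs wf => [//|gs g] _; rewrite !gate_scan_rcons last_rcons -cats1 big_cat big_seq1 /=.
rewrite geq_max => /andP[_]; rewrite /gate_depth.
case: g => [c|i|js|js] /=; first by left; exists c.
- by right; exists i.
- case: js => [|j js]; last by rewrite big_cons geq_max.
  by left; exists 0; rewrite big_nil mpolyC0.
- case: js => [|j js]; last by rewrite big_cons geq_max.
  by left; exists 1; rewrite big_nil mpolyC1.
Qed.

(** At depth zero A is a constant or a variable, and non-degeneracy leaves only A = z. Then T^k
    divides Phi, whose degree in T is below k. *)
Lemma approx_root_depth0 (F : fieldType) n k s (A : {mpoly F[n.+2]}) Phi :
  [pchar F] =i pred0 -> computable_by A 0 s ->
  approx_root k A Phi -> truncated k Phi -> non_degenerate A Phi -> Phi = 0.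
Proof.
move=> F0 [C [<- dC _]] [Q eQ] truncPhi; rewrite /non_degenerate.
have [[c ->]|[i eA]] := depth0_circuit_poly dC.
  by rewrite mderivC meval0 eqxx.
rewrite eA mderivX mnm1E; case: (i =P ord_max) => [ei _|_]; last by rewrite mulr0n scale0r meval0 eqxx.
have {eQ}eP : Phi = Q * 'X_ord0 ^+ k.
  rewrite -eQ /subst_z eA comp_mpolyXU -tnth_nth tnth_mktuple ei.
  by rewrite unlift_none.
apply: (mpoly_eq0_eval F0) => v.
pose x j := v (lift ord0 j).
have -> : Phi.@[v] = (root_at Phi x).[v ord0].
  rewrite horner_root_at; apply: meval_eq => j; rewrite /cons_pt.
  by case: unliftP => [j' ->|->].
suff -> : root_at Phi x = 0 by rewrite horner0.
apply/polyP => j; rewrite coef0; have [ltj|lej] := ltnP j k; last first.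
  by rewrite nth_default // (leq_trans (size_root_at truncPhi x)).
by rewrite /root_at eP rmorphM rmorphXn /= mmapX mmap1U cons_pt0 coefMXn ltj.
Qed.

Theorem theorem8p13 :
  exists a b c : nat,
  forall (F : fieldType) (n l k Delta s sigma mu rho d : nat)
    (A : 'I_l -> {mpoly F[n.+2]}) (Phi : 'I_l -> {mpoly F[n.+1]})
    (S : 'I_n -> {set 'I_mu}) (g : {mpoly F[sigma]})
    (C : circuit F (n.+1 + l)),
  [pchar F] =i pred0 ->
  (1 < k)%N ->
  (forall i : 'I_l,
     computable_by (A i) Delta s /\ T_regularized (A i) /\ monic_z (A i)) ->
  (forall i : 'I_l,
     [/\ approx_root k (A i) (Phi i), truncated k (Phi i)
       & non_degenerate (A i) (Phi i)]) ->
  is_design sigma rho S ->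
  mdegree g = d ->
  (circuit_depth C <= Delta)%N ->
  (circuit_size C <= s)%N ->
  let C' := subst_y (circuit_poly C) Phi in
  C' != 0 ->
  subst_KI g S C' = 0 ->
  exists G : circuit F sigma,
    [/\ circuit_poly G = g,
        (circuit_depth G <= a * Delta)%N
      & (circuit_size G <= (s + mdegree C' + k) ^ b
                           * (rho * trunc_log 2 k) ^ (c * d.+1 ^ c))%N].
Proof.
(* The circuit for g has depth 10 Delta + 17, which is at most 27 Delta for Delta > 0. The exponent
   [e.+1] ensures that d e is at most (e + 1) (d + 1)^(e + 1). *)
have [e eP] := implicit_cost_bound; exists 27, e, e.+1.
move=> F n l k Delta s sigma mu rho d A Phi S g C F0 k1 HA HPhi design dg dC sC C' C'0 C'KI.
have k0 : (0 < k)%N by apply: ltnW.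
have cardS i : #|S i| = sigma by case: design.
have [|i0 [t [x [w0 [H0 H1]]]]] := hybrid_argument F0 C'0 (K := KI g S).
  move=> t w; rewrite -[RHS](meval0 (cons_pt t w)) -C'KI.
  by rewrite [RHS]mmap_subst_KI.
(* For rho <= 1 the powers of rho do not dominate d, so this case is settled by a constant
   circuit. *)
have [rho1|rho2] := leqP rho 1.
  have [c ->] := constant_of_disjoint F0 design H0 H1 rho1.
  exact: computable_const.
(* For Delta = 0 the circuit for g must have depth zero as well. All the Phi_i vanish, so C' comes
   from a constant or a single variable with y = 0, and g turns out to be zero. *)
have [Delta0|Delta_gt0] := posnP Delta.
  suff -> : g = 0 by rewrite -(mpolyC0 sigma F); apply: computable_const.
  have Phi0 i : Phi i = 0.
    have [cA _] := HA i; have [r1 r2 r3] := HPhi i; rewrite Delta0 in cA.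
    exact: approx_root_depth0 F0 cA r1 r2 r3.
  have ev (h : 'I_n.+1 -> F) : C'.@[h] = (circuit_poly C).@[fun i =>
      match split i with inl j => h j | inr j => 0 end].
    rewrite [LHS]mmap_subst_y; apply: eq_mmap => // i; case: split => // j.
    by rewrite Phi0 mmap0.
  rewrite Delta0 in dC.
  have [[c ec]|[i ei]] := depth0_circuit_poly dC.
    by move: H1 (H0 w0); rewrite !ev ec !mevalC => /eqP.
  move: H1; rewrite ev ei mevalXU => H1.
  have {}H0 w := etrans (esym (H0 w)) (etrans (ev _) (congr1 (meval _) ei)).
  have {H0} : forall w, _ := fun w => etrans (H0 w) (mevalXU _ i).
  (* Only the variable x_(i0) is possible: for T, the y_j and the other x_j, the value in [H0] at w0
     coincides with the nonzero one in [H1]. For x_(i0), [H0] says that g vanishes. *)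
  case: (split i) H1 => [j|j]; last by rewrite eqxx.
  rewrite /cons_pt; case: unlift => [j'|]; last by move=> t0 /(_ w0) /esym/eqP; rewrite (negPf t0).
  case: (ltngtP j' i0) => [_|_|/val_inj->] x0 H0.
  - by case/eqP: x0; rewrite -(H0 w0).
  - by case/eqP: x0; rewrite -(H0 w0).
  apply: (mpoly_eq0_eval F0) => w.
  by rewrite [RHS](H0 (embed (S i0) w0 w)) /meval (mmap_KI_embed _ cardS).
have lt_rho : (0 < rho)%N by apply: ltnW.
pose sK := (rho ^ d * (d + 3))%N.
have comp (X : 'I_n -> {mpoly F[sigma]}) : (forall j, computable_by (X j) 3 sK) ->
    computable_by (mmap (@mpolyC sigma F) (cons_pt t%:MP X) C')
      (3 + 5 * Delta + 7 + 5 * Delta) (substitution_cost k s sK).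
  move=> cX; rewrite mmap_subst_y; apply: computable_subst => // i.
  case: split => j.
    rewrite /cons_pt; case: unlift => [j'|]; last exact: computable_const.
    by apply: (computableW (cX j')); rewrite ?leq_addr // -!addnA leq_addr.
  have [cA [rA _]] := HA j; have [r1 r2 r3] := HPhi j.
  apply: (computableW (computable_root F0 k0 cA cX rA r1 r2 r3 t)) => //.
  exact: leq_addl.
have [G [G1 G2 G3]] := hybrid_root_computable F0 design dg H0 H1 comp.
exists G; split=> //; first by lia.
apply: leq_trans G3 _.
pose B := (s + mdegree C' + k)%N; pose r := (rho ^ d)%N.
have r0 : (0 < r)%N by rewrite expn_gt0 lt_rho.
have ltd : (d < r)%N by apply: leq_trans (ltn_expl d rho2) _.
(* One base dominates every parameter: [B] bounds s, k and the degree of C', and rho^d exceeds d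
   because rho >= 2. The power Z^e splits into the polynomial factor and rho^(d e). *)
pose Z := (B * r)%N.
have leB m : (m <= B)%N -> (m <= Z)%N by move=> le; rewrite (leq_trans le) // leq_pmulr.
have B0 : (0 < B)%N by rewrite /B; lia.
have ler m : (m <= r)%N -> (m <= Z)%N by move=> le; rewrite (leq_trans le) // leq_pmull.
have := eP Z k s (mdegree C') d r; rewrite -/sK => /(_ _ _ _ _ _ _)/leq_trans; apply.
- by apply: leB; rewrite /B; lia.
- by apply: leB; rewrite /B; lia.
- by apply: leB; rewrite /B; lia.
- by apply: leB; rewrite /B; lia.
- by apply: ler; apply: ltnW.
- exact: ler.
rewrite /Z (expnMn B r e) leq_mul // /r -expnM.
(* As k > 1, the logarithm is at least 1, so rho may be replaced by rho log k. *)
have log1 : (0 < trunc_log 2 k)%N by rewrite trunc_log_gt0.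
have le1 : (rho <= rho * trunc_log 2 k)%N by rewrite leq_pmulr.
apply: leq_trans (_ : _ <= (rho * trunc_log 2 k) ^ (d * e))%N _.
  by case: (d * e)%N => [|m]; rewrite ?expn0 // leq_exp2r.
rewrite leq_pexp2l ?muln_gt0 ?lt_rho // mulnC leq_mul //.
by rewrite (leq_trans (leqnSn d)) // -[leqLHS]expn1 leq_pexp2l.
Qed.
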